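(* Let $M$ be a minimal submanifold of dimension $n$ in Euclidean space $\mathbb{R}^{m+n}$ (arbitrary codimension $m\ge1$), with second fundamental form $B$. Then $$|\nabla B|^2\ \ge\ \Big(1+\frac{2}{mn}\Big)\big|\nabla|B|\big|^2$$ at every point of $M$ where $|B|$ is differentiable (in particular at every point where $|B|\ne0$).
   Context: $M$ is smooth and isometrically immersed; minimal means that the mean curvature vector (the trace of $B$) vanishes. $B$ is viewed as a section of $\mathrm{Hom}(\odot^2TM,NM)$, where $NM$ is the normal bundle, and $\nabla B$ is its covariant derivative with respect to the connection induced from the Levi-Civita connection of $TM$ and the normal connection of $NM$. In local orthonormal tangent frames $\{e_i\}$ and normal frames $\{\nu_\alpha\}$, with $h_{\alpha ij}=\langle B_{e_ie_j},\nu_\alpha\rangle$ and $h_{\alpha ijk}=\langle(\nabla_{e_k}B)_{e_ie_j},\nu_\alpha\rangle$, one has $|B|^2=\sum_{\alpha,i,j}h_{\alpha ij}^2$ and $|\nabla B|^2=\sum_{\alpha,i,j,k}h_{\alpha ijk}^2$. *)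

(* Defs.v *)
From HB Require Import structures.
From mathcomp Require Import all_boot all_order all_algebra.
From mathcomp Require Import all_classical all_reals all_analysis.
Import Order.TTheory GRing.Theory Num.Theory.
Import numFieldNormedType.Exports.

Set Implicit Arguments.
Unset Strict Implicit.
Unset Printing Implicit Defensive.

Local Open Scope classical_set_scope.
Local Open Scope ring_scope.

(* C^oo on an open set U: iterated directional derivatives of every order
   exist and are differentiable at every point of U. *)
Definition smooth_on (R : realType) (n k : nat) (U : set 'rV[R]_n)
    (f : 'rV[R]_n -> 'rV[R]_k) : Prop :=
  forall (vs : seq 'rV[R]_n) (x : 'rV[R]_n), U x ->
    differentiable (foldr (fun v g => 'D_v g) f vs) x.

(* A chart is a homeomorphism from an open set of M onto an open set of R^n;
   [chart_coord] and [chart_param] are total functions, meaningful only on [chart_dom]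
   and [chart_im] respectively. *)
Record chart (R : realType) (n : nat) (M : topologicalType) := Chart {
  chart_dom : set M;
  chart_coord : M -> 'rV[R]_n;
  chart_param : 'rV[R]_n -> M }.

Definition chart_im (R : realType) (n : nat) (M : topologicalType)
  (c : chart R n M) : set 'rV[R]_n := chart_coord c @` chart_dom c.

Definition is_chart (R : realType) (n : nat) (M : topologicalType)
    (c : chart R n M) : Prop :=
  [/\ open (chart_dom c), open (chart_im c),
      (forall p, chart_dom c p -> chart_param c (chart_coord c p) = p),
      {within chart_dom c, continuous (chart_coord c)} &
      {within chart_im c, continuous (chart_param c)}].

Definition smooth_atlas (R : realType) (n : nat) (M : topologicalType)
    (A : set (chart R n M)) : Prop :=
  [/\ (forall c, A c -> is_chart c),
      (forall p : M, exists2 c, A c & chart_dom c p) &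
      (forall c c', A c -> A c' ->
         smooth_on (chart_coord c @` (chart_dom c `&` chart_dom c'))
                   (chart_coord c' \o chart_param c))].

Definition smooth_manifold (R : realType) (n : nat) (M : topologicalType)
    (A : set (chart R n M)) : Prop :=
  [/\ hausdorff_space M, @second_countable M & smooth_atlas A].

Definition smooth_immersion (R : realType) (n N : nat) (M : topologicalType)
    (A : set (chart R n M)) (F : M -> 'rV[R]_N) : Prop :=
  forall c, A c ->
    smooth_on (chart_im c) (F \o chart_param c) /\
    (forall x, chart_im c x ->
       injective (fun v : 'rV[R]_n => 'D_v (F \o chart_param c) x)).

Definition dotv (R : realType) (N : nat) (u v : 'rV[R]_N) : R :=
  \sum_(i < N) u 0 i * v 0 i.

(* Local geometry of an immersion in a chart.  X is the local expression
   F \o chart_param c of the immersion, a vector u : 'rV_n stands for the tangent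
   vector dX(u) and also for the coordinate field with constant components u.
   M carries the metric induced by the immersion, so that the immersion is
   isometric. *)

Definition pd (R : realType) (n : nat) (i : 'I_n) : 'rV[R]_n := delta_mx 0 i.

Definition metric (R : realType) (n N : nat) (X : 'rV[R]_n -> 'rV[R]_N)
    (u v x : 'rV[R]_n) : R :=
  dotv ('D_u X x) ('D_v X x).

Definition gram (R : realType) (n N : nat) (X : 'rV[R]_n -> 'rV[R]_N)
    (x : 'rV[R]_n) : 'M[R]_n :=
  \matrix_(i, j) metric X (pd R i) (pd R j) x.

(* Levi-Civita connection of the induced metric on constant coordinate fields:
   the components of nabla_u v, given by the Koszul formula (the Lie brackets
   vanish), i.e. u^i v^j Gamma^k_ij. *)
Definition levi_civita (R : realType) (n N : nat) (X : 'rV[R]_n -> 'rV[R]_N)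
    (u v x : 'rV[R]_n) : 'rV[R]_n :=
  (\row_l (2^-1 * ('D_u (metric X v (pd R l)) x
                   + 'D_v (metric X u (pd R l)) x
                   - 'D_(pd R l) (metric X u v) x)))
  *m invmx (gram X x).

(* Orthogonal projection of an ambient vector onto the normal space. *)
Definition normal_part (R : realType) (n N : nat) (X : 'rV[R]_n -> 'rV[R]_N)
    (x : 'rV[R]_n) (w : 'rV[R]_N) : 'rV[R]_N :=
  w - 'D_((\row_l dotv w ('D_(pd R l) X x)) *m invmx (gram X x)) X x.

(* B_{u v} = (D_u (dX(v)))^normal, D the flat connection of R^N. *)
Definition sff (R : realType) (n N : nat) (X : 'rV[R]_n -> 'rV[R]_N)
    (u v x : 'rV[R]_n) : 'rV[R]_N :=
  normal_part X x ('D_u ('D_v X) x).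

(* (nabla_w B)_{u v}; the normal connection is the normal part of D. *)
Definition nabla_sff (R : realType) (n N : nat) (X : 'rV[R]_n -> 'rV[R]_N)
    (w u v x : 'rV[R]_n) : 'rV[R]_N :=
  normal_part X x ('D_w (sff X u v) x)
  - sff X (levi_civita X w u x) v x
  - sff X u (levi_civita X w v x) x.

Definition mean_curvature (R : realType) (n N : nat)
    (X : 'rV[R]_n -> 'rV[R]_N) (x : 'rV[R]_n) : 'rV[R]_N :=
  \sum_(i < n) \sum_(j < n)
    (invmx (gram X x) i j) *: sff X (pd R i) (pd R j) x.

Definition minimal_immersion (R : realType) (n N : nat) (M : topologicalType)
    (A : set (chart R n M)) (F : M -> 'rV[R]_N) : Prop :=
  forall c, A c -> forall x, chart_im c x ->
    mean_curvature (F \o chart_param c) x = 0.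

(* Frame fields are arbitrary pointwise choices of orthonormal bases: the
   norms below do not depend on the choice, so no regularity is required. *)
Definition orthonormal_tangent_frame (R : realType) (n N : nat)
    (X : 'rV[R]_n -> 'rV[R]_N) (U : set 'rV[R]_n)
    (e : 'I_n -> 'rV[R]_n -> 'rV[R]_n) : Prop :=
  forall x, U x -> forall i j, metric X (e i x) (e j x) x = (i == j)%:R.

Definition orthonormal_normal_frame (R : realType) (n m : nat)
    (X : 'rV[R]_n -> 'rV[R]_(m + n)) (U : set 'rV[R]_n)
    (nu : 'I_m -> 'rV[R]_n -> 'rV[R]_(m + n)) : Prop :=
  forall x, U x ->
    (forall a b, dotv (nu a x) (nu b x) = (a == b)%:R) /\
    (forall a v, dotv (nu a x) ('D_v X x) = 0).

(* |B|, as a function on the chart. *)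
Definition sff_norm (R : realType) (n m : nat)
    (X : 'rV[R]_n -> 'rV[R]_(m + n)) (e : 'I_n -> 'rV[R]_n -> 'rV[R]_n)
    (nu : 'I_m -> 'rV[R]_n -> 'rV[R]_(m + n)) (x : 'rV[R]_n) : R :=
  Num.sqrt (\sum_(a < m) \sum_(i < n) \sum_(j < n)
    dotv (sff X (e i x) (e j x) x) (nu a x) ^+ 2).

(* |nabla B|^2 *)
Definition nabla_sff_norm2 (R : realType) (n m : nat)
    (X : 'rV[R]_n -> 'rV[R]_(m + n)) (e : 'I_n -> 'rV[R]_n -> 'rV[R]_n)
    (nu : 'I_m -> 'rV[R]_n -> 'rV[R]_(m + n)) (x : 'rV[R]_n) : R :=
  \sum_(a < m) \sum_(i < n) \sum_(j < n) \sum_(k < n)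
    dotv (nabla_sff X (e k x) (e i x) (e j x) x) (nu a x) ^+ 2.

(* |nabla f|^2 for the induced metric *)
Definition grad_norm2 (R : realType) (n : nat)
    (e : 'I_n -> 'rV[R]_n -> 'rV[R]_n) (f : 'rV[R]_n -> R)
    (x : 'rV[R]_n) : R :=
  \sum_(k < n) ('D_(e k x) f x) ^+ 2.

(* Main.v *)
Require Import Defs.
From HB Require Import structures.
From mathcomp Require Import all_boot all_order all_algebra.
From mathcomp Require Import all_classical all_reals all_analysis.
From mathcomp Require Import ring lra.
Import Order.TTheory GRing.Theory Num.Theory.
Import numFieldNormedType.Exports.

(* At a point with |B| <> 0 put T_k = sum h_aij h_aijk, so that
   |grad |B||^2 = |T|^2 / |B|^2, and H_aij = sum_k h_aijk T_k.  By
   Cauchy-Schwarz, |T|^4 <= |B|^2 |H|^2.  By the Codazzi equation and minimality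
   each h_a is a totally symmetric traceless 3-tensor, and contracting such a
   tensor with a vector loses norm: |H|^2 <= n / (n + 2) |T|^2 |h|^2.  Hence
   |grad |B||^2 <= n / (n + 2) |nabla B|^2, which gives even the constant
   1 + 2 / n.  Where |B| = 0 and |B| is differentiable, |B| has a minimum and
   its gradient vanishes.

   In a chart the tensor calculus becomes matrix calculus: with J the Jacobian
   of the immersion, the Gram matrix is G = J J^T, the normal projection is
   w - w J^T G^-1 J, and for each ambient coordinate t the form B is a symmetric
   matrix b^t.  With C the Christoffel matrix of a direction w one has
   D_w G = C G + G C^T, so that the covariant derivative
   D_w b^t - C b^t - b^t C^T appears when differentiating
   |B|^2 = sum_t tr (G^-1 b^t G^-1 b^t) and the mean curvature
   tr (G^-1 b^t). *)

Set Implicit Arguments.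
Unset Strict Implicit.
Unset Printing Implicit Defensive.

Local Open Scope classical_set_scope.
Local Open Scope ring_scope.

(** * Traceless symmetric tensors *)

Section TracelessTensors.
Context {R : realFieldType}.

Lemma sum_sqr_eq0 (I : finType) (x : I -> R) :
  \sum_i x i ^+ 2 = 0 -> forall i, x i = 0.
Proof.
move=> /eqP; rewrite psumr_eq0 => [/allP x0 i|i _]; last exact: sqr_ge0.
by have := x0 i (mem_index_enum i); rewrite sqrf_eq0 => /eqP.
Qed.

(** Every Cauchy-Schwarz type estimate below comes from the nonnegativity of such a sum for
    well-chosen [a] and [b]. *)
Lemma sum_sqr_lincomb (I : finType) (a b : R) (x y : I -> R) :
  \sum_i (a * x i - b * y i) ^+ 2 =
  a ^+ 2 * (\sum_i x i ^+ 2) - 2 * a * b * (\sum_i x i * y i)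
  + b ^+ 2 * (\sum_i y i ^+ 2).
Proof.
rewrite !mulr_sumr -sumrB -big_split; apply: eq_bigr => i _ /=; ring.
Qed.

Lemma cauchy_schwarz_sum (I : finType) (x y : I -> R) :
  (\sum_i x i * y i) ^+ 2 <= (\sum_i x i ^+ 2) * (\sum_i y i ^+ 2).
Proof.
set A := \sum_i x i ^+ 2; set B := \sum_i y i ^+ 2; set C := \sum_i _.
have B0 : 0 <= B by apply: sumr_ge0 => i _; exact: sqr_ge0.
have [BE|Bn0] := eqVneq B 0.
  rewrite BE mulr0 /C big1 ?expr0n// => i _.
  by rewrite (sum_sqr_eq0 BE) mulr0.
(* [B x - C y] is [B] times the part of [x] orthogonal to [y]. *)
have : 0 <= \sum_i (B * x i - C * y i) ^+ 2.
  by apply: sumr_ge0 => i _; exact: sqr_ge0.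
rewrite sum_sqr_lincomb -/A -/B -/C.
have -> : B ^+ 2 * A - 2 * B * C * C + C ^+ 2 * B = B * (A * B - C ^+ 2).
  by ring.
by rewrite pmulr_rge0 ?lt0r ?Bn0// subr_ge0.
Qed.

Lemma sum_delta (I : finType) (i : I) (f : I -> R) :
  \sum_j (i == j)%:R * f j = f i.
Proof.
rewrite (bigD1 i)//= eqxx mul1r big1 ?addr0// => j /negPf.
by rewrite eq_sym => ->; rewrite mul0r.
Qed.

(* Cauchy-Schwarz against the traceless symmetric part of [v t], whose squared
   norm is at most [(n - 1) / n * |v|^2 * |t|^2]. *)
Lemma traceless_apply_bound n (S : 'I_n -> 'I_n -> R) (t : 'I_n -> R) :
  (1 < n)%N ->
  (forall i j, S i j = S j i) -> \sum_i S i i = 0 ->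
  n%:R * (\sum_i (\sum_j S i j * t j) ^+ 2) <=
  (n%:R - 1) * ((\sum_i \sum_j S i j ^+ 2) * (\sum_i t i ^+ 2)).
Proof.
move=> n1 symS trS.
(* [v], [q] and [s] are kept abstract, lest [mulr_sumr] unfold them. *)
have [v vE] : {v | forall i, v i = \sum_j S i j * t j} by eexists.
under eq_bigr => i _ do rewrite -vE.
set V := \sum_i v i ^+ 2.
have [q qdef] : {q | q = \sum_i t i ^+ 2} by eexists.
rewrite -qdef.
set N := \sum_i \sum_j _; set d : R := n%:R.
have [s sE] : {s | s = \sum_i v i * t i} by eexists.
have d1 : 1 < d by rewrite ltr1n.
have q0 : 0 <= q by rewrite qdef; apply: sumr_ge0 => i _; exact: sqr_ge0.
have [qE|qn0] := eqVneq q 0.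
  rewrite qdef in qE.
  rewrite /V big1 ?mulr0 ?qdef ?qE ?mulr0// => i _.
  rewrite vE big1 ?expr0n// => j _.
  by rewrite (sum_sqr_eq0 qE) mulr0.
(* The trace of v t + t v is 2 s, so [K] is 2 d times the traceless symmetric part of v t. *)
pose K i j := d * (v i * t j + t i * v j) - 2 * s * (i == j)%:R.
(* Against a symmetric traceless [W] only the v t part counts. W = S gives <S, K>, and W = K gives
   |K|^2. *)
have WK (W : 'I_n -> 'I_n -> R) :
    (forall i j, W i j = W j i) -> \sum_i W i i = 0 ->
    \sum_i \sum_j W i j * K i j = 2 * d * \sum_i v i * \sum_j W i j * t j.
  move=> symW trW.
  have E1 : \sum_i \sum_j W i j * (v i * t j) =
      \sum_i v i * \sum_j W i j * t j.
    by apply: eq_bigr => i _; rewrite mulr_sumr; apply: eq_bigr => j _; ring.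
  have E2 : \sum_i \sum_j W i j * (t i * v j) =
      \sum_i v i * \sum_j W i j * t j.
    rewrite exchange_big /=; apply: eq_bigr => i _; rewrite mulr_sumr.
    by apply: eq_bigr => j _; rewrite symW; ring.
  have E3 : \sum_i \sum_j (i == j)%:R * W i j = 0.
    by rewrite -[RHS]trW; apply: eq_bigr => i _; rewrite sum_delta.
  transitivity (d * (\sum_i \sum_j W i j * (v i * t j))
    + d * (\sum_i \sum_j W i j * (t i * v j))
    - 2 * s * \sum_i \sum_j (i == j)%:R * W i j); last first.
    by rewrite E1 E2 E3; ring.
  rewrite !mulr_sumr -big_split -sumrB; apply: eq_bigr => i _ /=.
  rewrite !mulr_sumr -big_split -sumrB; apply: eq_bigr => j _ /=.
  by rewrite /K; ring.
have SK : \sum_i \sum_j S i j * K i j = 2 * d * V.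
  by rewrite WK//; congr (_ * _); apply: eq_bigr => i _; rewrite -vE expr2.
have KK : \sum_i \sum_j K i j ^+ 2 = 2 * d ^+ 2 * (V * q + s ^+ 2)
    - 4 * d * s ^+ 2.
  transitivity (\sum_i \sum_j K i j * K i j).
    by apply: eq_bigr => i _; apply: eq_bigr => j _; rewrite expr2.
  rewrite WK; last first.
  - rewrite /K (eq_bigr (fun i => 2 * d * (v i * t i) - 2 * s)); last first.
      by move=> i _; rewrite eqxx mulr1; ring.
    by rewrite sumrB -mulr_sumr -sE sumr_const card_ord -mulr_natr -/d; ring.
  - by move=> i j; rewrite /K eq_sym; ring.
  have Kt i : \sum_j K i j * t j = d * (v i * q + t i * s) - 2 * s * t i.
    transitivity (d * (v i * q + t i * s) - 2 * s * \sum_j (i == j)%:R * t j);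
      last by rewrite sum_delta.
    rewrite qdef {1}sE !mulr_sumr -big_split mulr_sumr -sumrB.
    by apply: eq_bigr => j _ /=; rewrite /K; ring.
  under eq_bigr => i _ do rewrite Kt.
  transitivity (2 * d * (d * q * (\sum_i v i ^+ 2)
    + (d - 2) * s * (\sum_i v i * t i))); last by rewrite -sE -/V; ring.
  congr (_ * _); rewrite !mulr_sumr -big_split /=.
  by apply: eq_bigr => i _; ring.
have sV : s ^+ 2 <= V * q by rewrite sE qdef; exact: cauchy_schwarz_sum.
(* The factor 2 (d - 1) q is the quotient of 4 d (d - 1) V q, the value of |K|^2 when s^2 = V q, by
   <S, K> = 2 d V. Having cancelled V in advance, no case V = 0 arises. *)
have : 0 <= \sum_p (2 * (d - 1) * q * S p.1 p.2 - 1 * K p.1 p.2) ^+ 2.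
  by apply: sumr_ge0 => p _; exact: sqr_ge0.
rewrite sum_sqr_lincomb.
have dbl (f : 'I_n -> 'I_n -> R) :
    \sum_p f p.1 p.2 = \sum_i \sum_j f i j by rewrite pair_bigA.
rewrite (dbl (fun i j => S i j ^+ 2)) (dbl (fun i j => K i j ^+ 2)).
rewrite (dbl (fun i j => S i j * K i j)).
rewrite -/N SK KK => H.
have d2 : 2 <= d by rewrite ler_nat.
(* Adding this replaces s^2 by its bound V q in |K|^2; the sign uses d >= 2. *)
have : 0 <= (2 * d ^+ 2 - 4 * d) * (V * q - s ^+ 2).
  by rewrite mulr_ge0 ?subr_ge0//; nra.
move=> H2; have H3 := addr_ge0 H H2.
have : 0 <= 4 * (d - 1) * q * ((d - 1) * (N * q) - d * V).
  by apply: (le_trans H3); rewrite le_eqVlt; apply/orP; left; apply/eqP; ring.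
by rewrite pmulr_rge0 ?subr_ge0// !mulr_gt0 ?subr_gt0// lt0r qn0.
Qed.

(* Cauchy-Schwarz against the projection of [H t] onto the traceless symmetric
   3-tensors, where [H i j = \sum_k h i j k * t k]: up to a factor 3 this
   projection is the tensor [K] below. *)
Lemma traceless_contract_bound n (h : 'I_n -> 'I_n -> 'I_n -> R)
    (t : 'I_n -> R) :
  (0 < n)%N ->
  (forall i j k, h i j k = h j i k) -> (forall i j k, h i j k = h i k j) ->
  (forall k, \sum_i h i i k = 0) ->
  (n%:R + 2) * (\sum_i \sum_j (\sum_k h i j k * t k) ^+ 2) <=
  n%:R * ((\sum_i \sum_j \sum_k h i j k ^+ 2) * (\sum_i t i ^+ 2)).
Proof.
move=> n0 sym12 sym23 tr.
(* In dimension 1 a traceless tensor is zero. *)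
case: (leqP n 1) => [|n1].
  case: n n0 h t sym12 sym23 tr => [//|[|//]] _ h t _ _ tr _.
  have h0 i j k : h i j k = 0.
    by rewrite !ord1 -(tr ord0) big_ord1.
  rewrite big1 ?mulr0; last first.
    move=> i _; rewrite big1// => j _; rewrite big1 ?expr0n// => k _.
    by rewrite h0 mul0r.
  rewrite !mulr_ge0//; do ?[apply: sumr_ge0 => ? _]; exact: sqr_ge0.
pose H i j := \sum_k h i j k * t k.
have [v vE] : {v | forall i, v i = \sum_j H i j * t j} by eexists.
have symH i j : H i j = H j i by apply: eq_bigr => k _; rewrite sym12.
have trH : \sum_i H i i = 0.
  rewrite exchange_big /= big1// => k _; rewrite -mulr_suml tr mul0r //.
(* [H] is again symmetric and traceless, so the previous bound controls v = H t. *)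
have := traceless_apply_bound t n1 symH trH.
under [X in _ * X <= _]eq_bigr => i _ do rewrite -vE.
set V := \sum_i v i ^+ 2.
have [q qdef] : {q | q = \sum_i t i ^+ 2} by eexists.
rewrite -qdef.
set N := \sum_i \sum_j H i j ^+ 2; set M := \sum_i \sum_j \sum_k _.
set d : R := n%:R => HV.
have d1 : 1 < d by rewrite ltr1n.
have q0 : 0 <= q by rewrite qdef; apply: sumr_ge0 => i _; exact: sqr_ge0.
have [qE|qn0] := eqVneq q 0.
  rewrite qdef in qE.
  suff -> : N = 0 by rewrite qdef qE !mulr0.
  rewrite /N big1// => i _; rewrite big1// => j _.
  by rewrite /H big1 ?expr0n// => k _; rewrite (sum_sqr_eq0 qE) mulr0.
have [s sE] : {s | s = \sum_i v i * t i} by eexists.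
(* The cyclic sum of H t has trace 2 v and that of delta v has trace (d + 2) v: these weights make
   [K] traceless, and it equals 3 (d + 2) times the projection. *)
pose K i j k := (d + 2) * (H i j * t k + H j k * t i + H i k * t j)
  - 2 * ((i == j)%:R * v k + (j == k)%:R * v i + (i == k)%:R * v j).
(* For symmetric traceless [W] the three H t terms contribute equally and the delta terms vanish. It
   serves for W = h and for W = K. *)
have WK (W : 'I_n -> 'I_n -> 'I_n -> R) :
    (forall i j k, W i j k = W j i k) -> (forall i j k, W i j k = W i k j) ->
    (forall k, \sum_i W i i k = 0) ->
    \sum_i \sum_j \sum_k W i j k * K i j k =
    3 * (d + 2) * \sum_i \sum_j H i j * \sum_k W i j k * t k.
  move=> symW symW' trW; set rhs := \sum_i \sum_j H i j * _.
  have E1 : \sum_i \sum_j \sum_k W i j k * (H i j * t k) = rhs.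
    apply: eq_bigr => i _; apply: eq_bigr => j _; rewrite mulr_sumr.
    by apply: eq_bigr => k _; ring.
  have E2 : \sum_i \sum_j \sum_k W i j k * (H i k * t j) = rhs.
    rewrite -E1; apply: eq_bigr => i _; rewrite exchange_big /=.
    by apply: eq_bigr => j _; apply: eq_bigr => k _; rewrite symW'.
  have E3 : \sum_i \sum_j \sum_k W i j k * (H j k * t i) = rhs.
    rewrite -E2 exchange_big /=; apply: eq_bigr => i _; apply: eq_bigr => j _.
    by apply: eq_bigr => k _; rewrite symW.
  have F1 : \sum_i \sum_j \sum_k (i == j)%:R * (v k * W i j k) = 0.
    under eq_bigr => i _ do (under eq_bigr => j _ do rewrite -mulr_sumr;
      rewrite sum_delta).
    rewrite exchange_big /= big1// => k _; rewrite -mulr_sumr trW mulr0//.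
  have F2 : \sum_i \sum_j \sum_k (i == k)%:R * (v j * W i j k) = 0.
    rewrite -[RHS]F1; apply: eq_bigr => i _; rewrite exchange_big /=.
    by apply: eq_bigr => j _; apply: eq_bigr => k _; rewrite symW'.
  have F3 : \sum_i \sum_j \sum_k (j == k)%:R * (v i * W i j k) = 0.
    rewrite -[RHS]F2 exchange_big /=.
    apply: eq_bigr => i _; apply: eq_bigr => j _.
    by apply: eq_bigr => k _; rewrite symW.
  transitivity ((d + 2) * (\sum_i \sum_j \sum_k W i j k * (H i j * t k))
    + (d + 2) * (\sum_i \sum_j \sum_k W i j k * (H i k * t j))
    + (d + 2) * (\sum_i \sum_j \sum_k W i j k * (H j k * t i))
    - 2 * (\sum_i \sum_j \sum_k (i == j)%:R * (v k * W i j k))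
    - 2 * (\sum_i \sum_j \sum_k (i == k)%:R * (v j * W i j k))
    - 2 * (\sum_i \sum_j \sum_k (j == k)%:R * (v i * W i j k))); last first.
    by rewrite E1 E2 E3 F1 F2 F3; ring.
  do 3!(rewrite !mulr_sumr -!big_split -!sumrB /=; apply: eq_bigr => ? _).
  by rewrite /K; ring.
have hK : \sum_i \sum_j \sum_k h i j k * K i j k = 3 * (d + 2) * N.
  by rewrite WK.
have KK : \sum_i \sum_j \sum_k K i j k ^+ 2 =
    3 * (d + 2) * ((d + 2) * (N * q) + 2 * d * V).
  transitivity (\sum_i \sum_j \sum_k K i j k * K i j k).
    by do 3!(apply: eq_bigr => ? _); rewrite expr2.
  rewrite WK; last first.
  - move=> k; rewrite /K (eq_bigr (fun i => (d + 2) * t k * H i i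
      + 2 * (d + 2) * (H k i * t i) - 2 * v k - 4 * ((k == i)%:R * v i))).
      rewrite !sumrB big_split /= -!mulr_sumr trH sum_delta.
      by rewrite sumr_const card_ord -mulr_natr -vE -/d; ring.
    by move=> i _; rewrite eqxx mul1r (symH i k) (eq_sym i k); ring.
  - by move=> i j k; rewrite /K (symH j k) (eq_sym j k); ring.
  - by move=> i j k; rewrite /K (symH i j) (eq_sym i j); ring.
  have Kt i j : \sum_k K i j k * t k = (d + 2) * (H i j * q)
      + d * (v j * t i + v i * t j) - 2 * s * (i == j)%:R.
    transitivity ((d + 2) * (H i j * (\sum_k t k ^+ 2)
      + t i * (\sum_k H j k * t k) + t j * (\sum_k H i k * t k))
      - 2 * (i == j)%:R * (\sum_k v k * t k)
      - 2 * v i * (\sum_k (j == k)%:R * t k)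
      - 2 * v j * (\sum_k (i == k)%:R * t k)); last first.
      by rewrite -qdef -!vE -sE !sum_delta; ring.
    rewrite !mulr_sumr -!big_split mulr_sumr -!sumrB.
    by apply: eq_bigr => k _ /=; rewrite /K; ring.
  congr (_ * _); under eq_bigr => i _ do under eq_bigr => j _ do rewrite Kt.
  have P1 : \sum_i \sum_j H i j * (v i * t j) = V.
    apply: eq_bigr => i _.
    transitivity (v i * \sum_j H i j * t j); last by rewrite -vE expr2.
    by rewrite mulr_sumr; apply: eq_bigr => j _; ring.
  have P2 : \sum_i \sum_j H i j * (v j * t i) = V.
    rewrite -P1 exchange_big /=; apply: eq_bigr => i _.
    by apply: eq_bigr => j _; rewrite symH.
  have P3 : \sum_i \sum_j (i == j)%:R * H i j = 0.
    by rewrite -[RHS]trH; apply: eq_bigr => i _; rewrite sum_delta.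
  transitivity ((d + 2) * q * N + d * (\sum_i \sum_j H i j * (v j * t i))
    + d * (\sum_i \sum_j H i j * (v i * t j))
    - 2 * s * (\sum_i \sum_j (i == j)%:R * H i j)).
    rewrite /N.
    do 2!(rewrite !mulr_sumr -!big_split -!sumrB /=; apply: eq_bigr => ? _).
    by ring.
  by rewrite P1 P2 P3; ring.
(* By [HV], |K|^2 is at most 9 d (d + 2) N q; dividing by <h, K> = 3 (d + 2) N gives the factor 3 d
   q. *)
have : 0 <= \sum_p (3 * d * q * h p.1.1 p.1.2 p.2 - 1 * K p.1.1 p.1.2 p.2) ^+ 2.
  by apply: sumr_ge0 => p _; exact: sqr_ge0.
rewrite sum_sqr_lincomb.
have trip (f : 'I_n -> 'I_n -> 'I_n -> R) :
    \sum_p f p.1.1 p.1.2 p.2 = \sum_i \sum_j \sum_k f i j k.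
  rewrite -(pair_bigA _ (fun p k => f p.1 p.2 k)) /=.
  by rewrite -(pair_bigA _ (fun i j => \sum_k f i j k)).
rewrite (trip (fun i j k => h i j k ^+ 2)) (trip (fun i j k => K i j k ^+ 2)).
rewrite (trip (fun i j k => h i j k * K i j k)) -/M hK KK => Hge.
(* A multiple of [HV], which eliminates V from |K|^2. *)
have : 0 <= 6 * (d + 2) * ((d - 1) * (N * q) - d * V).
  by rewrite mulr_ge0 ?subr_ge0// mulr_ge0//; lra.
move=> H2; have H3 := addr_ge0 Hge H2.
have : 0 <= 9 * d * q * (d * (M * q) - (d + 2) * N).
  apply: (le_trans H3); rewrite le_eqVlt; apply/orP; left; apply/eqP; ring.
by rewrite pmulr_rge0 ?subr_ge0// !mulr_gt0 ?lt0r ?qn0//; lra.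
Qed.

(** The pointwise algebraic core: [b] and [h] stand for the components of B and nabla B in
    orthonormal frames. *)
Lemma kato_traceless n m (b : 'I_m -> 'I_n -> 'I_n -> R)
    (h : 'I_m -> 'I_n -> 'I_n -> 'I_n -> R) :
  (0 < n)%N -> (0 < m)%N ->
  (forall a i j k, h a i j k = h a j i k) ->
  (forall a i j k, h a i j k = h a i k j) ->
  (forall a k, \sum_i h a i i k = 0) ->
  (1 + 2 / (m%:R * n%:R)) *
    \sum_k (\sum_a \sum_i \sum_j b a i j * h a i j k) ^+ 2 <=
  (\sum_a \sum_i \sum_j b a i j ^+ 2) *
    (\sum_a \sum_i \sum_j \sum_k h a i j k ^+ 2).
Proof.
move=> n0 m0 sym12 sym23 tr.
pose T k := \sum_a \sum_i \sum_j b a i j * h a i j k.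
rewrite -[X in _ * X <= _]/(\sum_k T k ^+ 2); set q := \sum_k T k ^+ 2.
set B := \sum_a \sum_i \sum_j b a i j ^+ 2; set M := \sum_a _.
pose H a i j := \sum_k h a i j k * T k.
pose N := \sum_a \sum_i \sum_j H a i j ^+ 2.
have B0 : 0 <= B by do 3!(apply: sumr_ge0 => ? _); exact: sqr_ge0.
have M0 : 0 <= M by do 4!(apply: sumr_ge0 => ? _); exact: sqr_ge0.
have q0 : 0 <= q by apply: sumr_ge0 => ? _; exact: sqr_ge0.
have d0 : (0 : R) < n%:R by rewrite ltr0n.
have dm0 : (1 : R) <= m%:R by rewrite ler1n.
have NM : (n%:R + 2) * N <= n%:R * (M * q).
  rewrite /N /M mulr_suml !mulr_sumr; apply: ler_sum => a _.
  exact: traceless_contract_bound.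
have trip (f : 'I_m -> 'I_n -> 'I_n -> R) :
    \sum_p f p.1.1 p.1.2 p.2 = \sum_i \sum_j \sum_k f i j k.
  rewrite -(pair_bigA _ (fun p k => f p.1 p.2 k)) /=.
  by rewrite -(pair_bigA _ (fun i j => \sum_k f i j k)).
(* After exchanging sums, q = |T|^2 is the inner product of [b] and [H]. *)
have qBN : q ^+ 2 <= B * N.
  have := cauchy_schwarz_sum (fun p => b p.1.1 p.1.2 p.2)
    (fun p => H p.1.1 p.1.2 p.2).
  rewrite (trip (fun a i j => b a i j ^+ 2)) (trip (fun a i j => H a i j ^+ 2)).
  rewrite (trip (fun a i j => b a i j * H a i j)) -/B -/N.
  rewrite (_ : \sum_a _ = q)// /q.
  transitivity (\sum_k \sum_a \sum_i \sum_j (b a i j * h a i j k) * T k).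
    rewrite [RHS]exchange_big /=; apply: eq_bigr => a _.
    rewrite [RHS]exchange_big /=; apply: eq_bigr => i _.
    rewrite [RHS]exchange_big /=; apply: eq_bigr => j _.
    by rewrite mulr_sumr; apply: eq_bigr => k _; ring.
  apply: eq_bigr => k _; rewrite expr2 {2}/T.
  by do 3!(rewrite mulr_suml; apply: eq_bigr => ? _).
have [->|qn0] := eqVneq q 0; first by rewrite mulr0 mulr_ge0.
have qgt0 : 0 < q by rewrite lt0r qn0.
(* The two bounds chain to (n + 2) q^2 <= n B M q, and q cancels. *)
have le1 : (n%:R + 2) * q <= n%:R * (B * M).
  rewrite -(ler_pM2r qgt0); have := ler_wpM2l B0 NM.
  have : (n%:R + 2) * q ^+ 2 <= (n%:R + 2) * (B * N).
    by rewrite ler_wpM2l// addr_ge0.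
  by nra.
(* The constant 1 + 2 / n is weakened using m >= 1. *)
apply: (@le_trans _ _ ((1 + 2 / n%:R) * q)).
  rewrite ler_wpM2r// lerD2l ler_pM2l// lef_pV2 ?posrE ?mulr_gt0 ?ltr0n//.
  by rewrite ler_peMl// ltW.
rewrite -(ler_pM2l d0) mulrA mulrDr mulr1 mulrCA divff ?mulr1//.
exact: lt0r_neq0.
Qed.

End TracelessTensors.

(** * Differential calculus *)

Section Differentiability.
Context {R : realType} {V W : normedModType R}.

Lemma differentiable_bigsum (I : finType) (f : I -> V -> W) (x : V) :
  (forall i, differentiable (f i) x) ->
  differentiable (fun y => \sum_i f i y) x.
Proof.
move=> df; rewrite (_ : (fun _ => _) = \sum_i f i); last first.
  by apply/funext => y; rewrite fct_sumE.
by elim/big_ind : _ => // g h; exact: differentiableD.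
Qed.

Lemma derive_bigsum (I : finType) (f : I -> V -> W) (x v : V) :
  (forall i, derivable (f i) x v) ->
  'D_v (fun y => \sum_i f i y) x = \sum_i 'D_v (f i) x.
Proof.
move=> df; rewrite (_ : (fun _ => _) = \sum_i f i); last first.
  by apply/funext => y; rewrite fct_sumE.
suff H : is_derive x v (\sum_i f i) (\sum_i 'D_v (f i) x) by exact: derive_val.
elim/big_ind2 : _ => [|g dg h dh dgv dhv|i _]; last exact/derivableP.
- exact: is_derive_cst.
- exact: is_deriveD.
Qed.

Lemma differentiable_mul (f g : V -> R) (x : V) :
  differentiable f x -> differentiable g x ->
  differentiable (fun y => f y * g y) x.
Proof. exact: differentiableM. Qed.

Lemma differentiable_bigprod (I : finType) (f : I -> V -> R) (x : V) :
  (forall i, differentiable (f i) x) ->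
  differentiable (fun y => \prod_i f i y) x.
Proof.
move=> df; elim: (index_enum I) => [|i s IHs].
  rewrite (_ : (fun _ => _) = cst 1); first exact: differentiable_cst.
  by apply/funext => y; rewrite big_nil.
rewrite (_ : (fun _ => _) = f i * (fun y => \prod_(j <- s) f j y)).
  exact: differentiableM.
by apply/funext => y; rewrite big_cons.
Qed.

(** The two functions share their first-order expansion. This transfers identities that hold only on
    the open chart image to total functions. *)
Lemma near_eq_differentiable (f g : V -> W) (x : V) :
  (\near x, f x = g x) -> differentiable f x -> differentiable g x.
Proof.
move=> fg df; have fgx := nbhs_singleton fg.
have dfo : g \o shift x = cst (g x) + 'd f x +o_ 0 id.
  apply/eqaddoP => e e0.
  have [_ /eqaddoP /(_ e e0) H] := (diff_locallyP _ _).1 df.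
  have fg0 : \forall h \near 0, f (h + x) = g (h + x).
    by move: fg; rewrite (near_shift 0)/= subr0.
  near=> h; have : f (h + x) = g (h + x) by near: h.
  have : `|(f \o shift x - (cst (f x) + 'd f x)) h| <= e * `|h| by near: h.
  by rewrite !fctE /= fgx => + <-.
have dg : 'd g x = 'd f x :> (V -> W).
  by apply: diff_unique => //; exact: diff_continuous.
by apply/diff_locallyP; rewrite dg; split => //; exact: diff_continuous.
Unshelve. all: by end_near. Qed.

Lemma derive_linear_combination (I : finType) (f : V -> W) (x : V)
    (a : I -> R) (v : I -> V) : differentiable f x ->
  'D_(\sum_i a i *: v i) f x = \sum_i a i *: 'D_(v i) f x.
Proof.
move=> df; rewrite deriveE// linear_sum; apply: eq_bigr => i _.
by rewrite linearZ deriveE.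
Qed.

End Differentiability.

Section MatrixValued.
Context {R : realType} {V : normedModType R}.

Lemma differentiable_mxP m n (f : V -> 'M[R]_(m, n)) (x : V) :
  differentiable f x <-> forall i j, differentiable (fun y => f y i j) x.
Proof.
split=> [df i j|df].
  exact: (differentiable_comp (g := fun M : 'M[R]_(m, n) => M i j) df
    (differentiable_coord _ _ _)).
rewrite (_ : f = fun y => \sum_i \sum_j f y i j *: delta_mx i j); last first.
  by apply/funext => y; exact: matrix_sum_delta.
by apply: differentiable_bigsum => i; apply: differentiable_bigsum => j;
  exact: differentiableZl.
Qed.

Lemma differentiable_det n (f : V -> 'M[R]_n) (x : V) :
  (forall i j, differentiable (fun y => f y i j) x) ->
  differentiable (fun y => \det (f y)) x.
Proof.
move=> df; apply: differentiable_bigsum => s.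
apply: differentiable_mul; first exact: differentiable_cst.
exact: differentiable_bigprod.
Qed.

Lemma differentiable_invmx n (f : V -> 'M[R]_n) (x : V) :
  (\forall y \near x, f y \in unitmx) ->
  (forall i j, differentiable (fun y => f y i j) x) ->
  forall i j, differentiable (fun y => invmx (f y) i j) x.
Proof.
move=> fu df i j.
(* The cofactor formula, valid where [f y] is invertible. *)
pose g y := (\det (f y))^-1 * ((-1) ^+ (j + i) * \det (row' j (col' i (f y)))).
apply: (@near_eq_differentiable _ _ _ g).
  near=> y; have fyu : f y \in unitmx by near: y.
  by rewrite /invmx fyu !mxE.
have dd := differentiable_det df.
apply: differentiable_mul.
  apply: differentiableV => //.
  by have := nbhs_singleton fu; rewrite unitmxE unitfE.
apply: differentiable_mul; first exact: differentiable_cst.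
apply: differentiable_det => k l.
rewrite (_ : (fun _ => _) = fun y => f y (lift j k) (lift i l)) //.
by apply/funext => y; rewrite !mxE.
Unshelve. all: by end_near. Qed.

End MatrixValued.

(** * Symmetry of second derivatives *)

Section Schwarz.
Context {R : realType} {V : normedModType R}.

Lemma is_derive_along_line (f : V -> R) (y v : V) (t : R) :
  derivable f (y + t *: v) v ->
  is_derive t 1 (fun s => f (y + s *: v)) ('D_v f (y + t *: v)).
Proof.
pose q (h : R) := h^-1 *: (f (h *: v + (y + t *: v)) - f (y + t *: v)).
have qE : (fun h : R => h^-1 *: (f (y + (h *: 1 + t) *: v) - f (y + t *: v)))
    = q.
  apply/funext => h; rewrite /q scalerDl [h *: 1]mulr1 addrCA.
  by rewrite addrA.
by split; rewrite /derivable /derive /= qE.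
Qed.

(** The mean value theorem in the direction [v] turns the second difference into a difference of
    values of ['D_v f], which is then expanded to first order at [x]. Differentiability of ['D_v f]
    at the single point [x] suffices. *)
Lemma second_difference (f : V -> R) (x u v : V) :
  (\forall y \near x, differentiable f y) -> differentiable ('D_v f) x ->
  forall e : R, 0 < e -> \forall s \near 0^'+,
  `|f (x + s *: u + s *: v) - f (x + s *: u) - (f (x + s *: v) - f x)
     - s ^+ 2 * 'D_u ('D_v f) x| <= e * s ^+ 2.
Proof.
move=> df dv e e0.
(* The two error terms at the end add up to e / C times s (|u| + 2 |v|); the summand 1 keeps [C]
   positive. *)
pose C : R := `|u| + 2 * `|v| + 1.
have C0 : 0 < C by rewrite ltr_wpDl// addr_ge0// mulr_ge0.
have eC0 : 0 < e / C by rewrite divr_gt0.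
have [_ /eqaddoP /(_ _ eC0)] := (diff_locallyP _ _).1 dv.
move=> /nbhs_ballP[d1 /= d10 Hd1].
move: df => /nbhs_ballP[d2 /= d20 Hd2].
pose d := Num.min d1 d2 / C.
have d0 : 0 < d by rewrite divr_gt0// lt_min d10.
(* The boolean selects between the displacements s u + t v and t v, treated alike. *)
have small (s t : R) (a : bool) : 0 < s < d -> 0 <= t <= s ->
    `|s *: (a%:R *: u) + t *: v| < Num.min d1 d2 /\
    `|s *: (a%:R *: u) + t *: v| <= s * (a%:R * `|u| + `|v|).
  move=> /andP[s0 sd] /andP[t0 ts].
  have H : `|s *: (a%:R *: u) + t *: v| <= s * (a%:R * `|u| + `|v|).
    rewrite (le_trans (ler_normD _ _))// !normrZ (ger0_norm t0) gtr0_norm//.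
    by rewrite mulrDr normr_nat lerD2l ler_wpM2r.
  split => //; apply: (le_lt_trans H).
  apply: (@le_lt_trans _ _ (s * C)); last by rewrite -ltr_pdivlMr.
  rewrite ler_pM2l// /C; case: a {H}; rewrite ?mul0r ?mul1r ?add0r.
    by have := normr_ge0 v; lra.
  by have := normr_ge0 v; have := normr_ge0 u; lra.
near=> s.
have s0 : 0 < s by near: s; exact: nbhs_right_gt.
have sd : s < d by near: s; exact: nbhs_right_lt.
have s0d : 0 < s < d by rewrite s0.
(* The gap of [f] between two parallel segments in the direction [v]; its increment over [0, s] is
   the second difference. *)
pose phi (t : R) := f (x + s *: u + t *: v) - f (x + t *: v).
pose dphi (t : R) := 'D_v f (x + s *: u + t *: v) - 'D_v f (x + t *: v).
have line (y : V) (t : R) : differentiable f (y + t *: v) ->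
    is_derive t 1 (fun t => f (y + t *: v)) ('D_v f (y + t *: v)).
  by move=> dfy; apply: is_derive_along_line; exact: diff_derivable.
have H t : 0 <= t <= s -> is_derive t 1 phi (dphi t).
  move=> ts; apply: is_deriveB; apply: line; apply: Hd2.
    rewrite -ball_normE /= -addrA opprD addNKr normrN.
    have [] := small s t true s0d ts; rewrite scale1r.
    by rewrite lt_min => /andP[].
  rewrite -ball_normE /= opprD addNKr normrN.
  have [] := small s t false s0d ts; rewrite scale0r scaler0 add0r.
  by rewrite lt_min => /andP[].
have [||c] := @MVT R phi dphi 0 s s0.
- by move=> t; rewrite in_itv/= => /andP[t0 ts]; apply: H; rewrite !ltW.
- apply: derivable_within_continuous => t; rewrite in_itv/= => ts.
  by have [] := H t ts.
rewrite in_itv /= => /andP[c0 cs].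
have c0s : 0 <= c <= s by rewrite !ltW.
rewrite subr0 => E.
have -> : f (x + s *: u + s *: v) - f (x + s *: u) - (f (x + s *: v) - f x)
    = phi s - phi 0 by rewrite /phi !scale0r !addr0; ring.
rewrite E mulrC expr2 -mulrA -mulrBr normrM gtr0_norm// mulrCA ler_pM2l//.
have err (a : bool) :
    `|'D_v f (x + s *: (a%:R *: u) + c *: v)
      - ('D_v f x + 'd ('D_v f) x (s *: (a%:R *: u) + c *: v))|
    <= e / C * (s * (a%:R * `|u| + `|v|)).
  have [h1 h2] := small s c a s0d c0s.
  apply: le_trans (ler_wpM2l (ltW eC0) h2).
  have := Hd1 (s *: (a%:R *: u) + c *: v).
  rewrite -ball_normE /= sub0r normrN !fctE /=.
  rewrite (_ : _ + _ + x = x + s *: (a%:R *: u) + c *: v); last first.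
    by rewrite addrC addrA.
  by apply; move: h1; rewrite lt_min => /andP[].
(* Both expansions contain the term [Dc], so it cancels in the difference and s [Du] remains. *)
pose A : R := 'D_v f (x + s *: u + c *: v); pose B : R := 'D_v f (x + c *: v).
pose D0 : R := 'D_v f x; pose Du : R := 'd ('D_v f) x u.
pose Dc : R := 'd ('D_v f) x (c *: v).
have e1 : `|A - (D0 + (s * Du + Dc))| <= e / C * (s * (`|u| + `|v|)).
  by have := err true; rewrite scale1r mul1r linearP.
have e2 : `|B - (D0 + Dc)| <= e / C * (s * `|v|).
  by have := err false; rewrite scale0r scaler0 mul0r !add0r addr0.
have -> : dphi c - s * 'D_u ('D_v f) x
    = (A - (D0 + (s * Du + Dc))) - (B - (D0 + Dc)).
  by rewrite /dphi (deriveE u dv) -/A -/B -/Du; ring.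
apply: (le_trans (ler_normB _ _)); apply: (le_trans (lerD e1 e2)).
have eE : e = e / C * C by rewrite divfK// gt_eqF.
have : 0 <= e / C * s by rewrite mulr_ge0 ?ltW.
move=> ks0; rewrite [X in _ <= X * s]eE; set k := e / C in ks0 *.
rewrite -subr_ge0; apply: le_trans ks0 _; rewrite le_eqVlt; apply/orP; left.
by apply/eqP; rewrite /C; ring.
Unshelve. all: by end_near. Qed.

(** The second difference is symmetric in [u] and [v], so both iterated derivatives approximate the
    same quantity up to an arbitrarily small multiple of s^2. *)
Lemma derive_comm (f : V -> R) (x u v : V) :
  (\forall y \near x, differentiable f y) ->
  differentiable ('D_u f) x -> differentiable ('D_v f) x ->
  'D_u ('D_v f) x = 'D_v ('D_u f) x.
Proof.
move=> df du dv; apply/eqP; rewrite -subr_eq0 -normr_eq0 eq_le normr_ge0 andbT.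
apply/ler_addgt0Pr => e e0; rewrite add0r.
have e20 : 0 < e / 2 by rewrite divr_gt0.
have H1 := second_difference u df dv e20.
have H2 := second_difference v df du e20.
have [s [[h1 h2] s0]] :=
  filter_ex (filterI (filterI H1 H2) (nbhs_right_gt (0 : R))).
have E : x + s *: v + s *: u = x + s *: u + s *: v by rewrite addrAC.
move: h2; rewrite E => h2.
rewrite -(ler_pM2l (exprn_gt0 2 s0)) -[X in X * _ <= _]ger0_norm ?sqr_ge0//.
rewrite -normrM; move: h1 h2.
move: (f _) (f _) (f _) (f _) ('D_u _ _) ('D_v _ _) (s ^+ 2).
move=> a1 a2 a3 a4 b1 b2 t h1 h2.
have -> : t * (b1 - b2) = (a4 - a2 - (a3 - a1) - t * b2)
  - (a4 - a3 - (a2 - a1) - t * b1) by ring.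
apply: (le_trans (ler_normB _ _)).
have -> : t * e = e / 2 * t + e / 2 * t by field.
exact: (lerD h2 h1).
Qed.

End Schwarz.

(** * Derivatives of matrix products, traces and inverses, and at minima *)

Section MatrixDerivatives.
Context {R : realType} {V : normedModType R}.

Lemma derive_mxE m n (f : V -> 'M[R]_(m, n)) (x v : V) i j :
  derivable f x v -> ('D_v f x) i j = 'D_v (fun y => f y i j) x.
Proof. by move=> df; rewrite derive_mx// mxE. Qed.

Lemma differentiable_trmx m n (f : V -> 'M[R]_(m, n)) (x : V) :
  differentiable f x -> differentiable (fun y => (f y)^T) x.
Proof.
move=> /differentiable_mxP df; apply/differentiable_mxP => i j.
rewrite (_ : (fun _ => _) = fun y => f y j i)//.
by apply/funext => y; rewrite mxE.
Qed.

Lemma differentiable_mulmx m n p (f : V -> 'M[R]_(m, n)) (g : V -> 'M[R]_(n, p))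
    (x : V) :
  differentiable f x -> differentiable g x ->
  differentiable (fun y => f y *m g y) x.
Proof.
move=> /differentiable_mxP df /differentiable_mxP dg.
apply/differentiable_mxP => i j.
rewrite (_ : (fun _ => _) = fun y => \sum_k f y i k * g y k j); last first.
  by apply/funext => y; rewrite mxE.
by apply: differentiable_bigsum => k; exact: differentiable_mul.
Qed.

Lemma derive_mulmx m n p (f : V -> 'M[R]_(m, n)) (g : V -> 'M[R]_(n, p))
    (x v : V) :
  differentiable f x -> differentiable g x ->
  'D_v (fun y => f y *m g y) x = 'D_v f x *m g x + f x *m 'D_v g x.
Proof.
move=> df dg; apply/matrixP => i j.
rewrite derive_mxE; last exact/diff_derivable/differentiable_mulmx.
rewrite (_ : (fun _ => _) = fun y => \sum_k f y i k * g y k j); last first.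
  by apply/funext => y; rewrite mxE.
have dfe k : differentiable (fun y => f y i k) x.
  by move/differentiable_mxP : df.
have dge k : differentiable (fun y => g y k j) x.
  by move/differentiable_mxP : dg.
rewrite derive_bigsum => [|k]; last exact/diff_derivable/differentiable_mul.
rewrite !mxE -big_split; apply: eq_bigr => k _ /=.
rewrite [LHS]deriveM; [|exact: diff_derivable..].
rewrite !derive_mxE; [|exact: diff_derivable..].
by rewrite /= addrC; congr (_ + _); exact: mulrC.
Qed.

Lemma derive_mulmx_cst m n p q (A : 'M[R]_(m, n)) (B : 'M[R]_(p, q))
    (f : V -> 'M[R]_(n, p)) (x v : V) : differentiable f x ->
  'D_v (fun y => A *m f y *m B) x = A *m 'D_v f x *m B.
Proof.
move=> df.
have dA : differentiable (fun y => cst A y) x by exact: differentiable_cst.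
have dB : differentiable (fun y => cst B y) x by exact: differentiable_cst.
have dAf : differentiable (fun y => cst A y *m f y) x.
  exact: differentiable_mulmx.
transitivity ('D_v (fun y => cst A y *m f y *m cst B y) x) => //.
by rewrite !derive_mulmx// !derive_cst mulmx0 addr0 mul0mx add0r.
Qed.

Lemma differentiable_mxtrace n (f : V -> 'M[R]_n) (x : V) :
  differentiable f x -> differentiable (fun y => \tr (f y)) x.
Proof.
by move=> /differentiable_mxP df; apply: differentiable_bigsum => i.
Qed.

Lemma derive_mxtrace n (f : V -> 'M[R]_n) (x v : V) :
  differentiable f x -> 'D_v (fun y => \tr (f y)) x = \tr ('D_v f x).
Proof.
move=> df; have dfe i : differentiable (fun y => f y i i) x.
  by move/differentiable_mxP : df.
rewrite derive_bigsum => [|i]; last exact: diff_derivable.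
by apply: eq_bigr => i _; rewrite derive_mxE//; exact: diff_derivable.
Qed.

(** Obtained by differentiating f f^-1 = 1, which holds near [x]. *)
Lemma derive_invmx n (f : V -> 'M[R]_n) (x v : V) :
  (\forall y \near x, f y \in unitmx) -> differentiable f x ->
  'D_v (fun y => invmx (f y)) x
  = - (invmx (f x) *m 'D_v f x *m invmx (f x)).
Proof.
move=> fu df; have fxu := nbhs_singleton fu.
have dif : differentiable (fun y => invmx (f y)) x.
  by apply/differentiable_mxP; apply: differentiable_invmx => //;
    exact/differentiable_mxP.
have : 'D_v (fun y => f y *m invmx (f y)) x = 0.
  rewrite (near_eq_derive (g := cst 1%:M)) ?derive_cst//.
  by near=> y; rewrite mulmxV//; near: y.
rewrite derive_mulmx// => /(congr1 (mulmx (invmx (f x)))).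
rewrite mulmxDr mulmx0 mulKmx// mulmxA => /eqP; rewrite addrC.
by rewrite addr_eq0 => /eqP.
Unshelve. all: by end_near. Qed.

Lemma derive_comm_mx m n (f : V -> 'M[R]_(m, n)) (x u v : V) :
  (\forall y \near x, differentiable f y) ->
  differentiable ('D_u f) x -> differentiable ('D_v f) x ->
  'D_u ('D_v f) x = 'D_v ('D_u f) x.
Proof.
move=> df du dv; apply/matrixP => i j.
have E w : \forall y \near x, 'D_w f y i j = 'D_w (fun z => f z i j) y.
  by near=> y; rewrite derive_mxE//; apply: diff_derivable; near: y.
have dE w : differentiable ('D_w f) x ->
    differentiable ('D_w (fun z => f z i j)) x.
  by move=> /differentiable_mxP dw; exact: near_eq_differentiable (E w) _.
rewrite [LHS](derive_mxE i j); last exact: diff_derivable.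
rewrite [RHS](derive_mxE i j); last exact: diff_derivable.
rewrite (near_eq_derive _ (E v)) (near_eq_derive _ (E u)).
apply: derive_comm; [|exact: dE..].
near=> y; have : differentiable f y by near: y.
by move=> /differentiable_mxP.
Unshelve. all: by end_near. Qed.

(** Difference quotients from the right are nonnegative in the directions [v] and [- v]. This
    settles the points where |B| vanishes. *)
Lemma derive_at_min (f : V -> R) (x v : V) :
  differentiable f x -> (forall y, f x <= f y) -> 'D_v f x = 0.
Proof.
move=> df fmin.
have ge0 w : 0 <= 'D_w f x.
  have dfw : derivable f x w by exact: diff_derivable.
  rewrite /derive cvg_at_rightE//.
  apply: limr_ge; last first.
    near=> h; have h0 : 0 < h by near: h; exact: nbhs_right_gt.
    by apply: mulr_ge0; rewrite ?subr_ge0 ?fmin// invr_ge0 ltW.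
  apply/cvg_ex; eexists => A /dfw /nbhs_ballP [_ /posnumP[d] xdA].
  by exists d%:num => //= y xdy /gt_eqF/negbT/xdA; exact.
apply/eqP; rewrite eq_le ge0 andbT.
have := ge0 (- v); rewrite !deriveE// linearN.
by rewrite oppr_ge0.
Unshelve. all: by end_near. Qed.

End MatrixDerivatives.

(** * Christoffel terms under the trace *)

Section TraceIdentities.
Context {R : comNzRingType} {n : nat}.
Implicit Types G b D C : 'M[R]_n.

(** Here [G] is the inverse Gram matrix, with derivative -(G C + C^T G), and [D] is the derivative
    of [b]. The left side is the derivative of tr (G b); cyclicity of the trace moves the
    Christoffel terms onto [b]. *)
Lemma mxtrace_covariant1 G b D C :
  \tr (- (G *m C + C^T *m G) *m b + G *m D)
  = \tr ((D - C *m b - b *m C^T) *m G).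
Proof.
have E1 : \tr (G *m C *m b) = \tr (C *m b *m G).
  by rewrite -mulmxA mxtrace_mulC.
have E2 : \tr (C^T *m G *m b) = \tr (b *m C^T *m G).
  by rewrite mxtrace_mulC mulmxA.
rewrite mulNmx mulmxDl !mulmxBl !(mxtraceD, raddfN) /=.
by rewrite mxtraceD E1 E2 (mxtrace_mulC G D); ring.
Qed.

(** The same regrouping for half the derivative of tr (G b G b). *)
Lemma mxtrace_covariant2 G b D C :
  \tr ((- (G *m C + C^T *m G) *m b + G *m D) *m (G *m b))
  = \tr (G *m (D - C *m b - b *m C^T) *m (G *m b)).
Proof.
have E : \tr (C^T *m G *m b *m (G *m b)) = \tr (G *m b *m C^T *m (G *m b)).
  by rewrite -(mulmxA C^T G b) mxtrace_mulC !mulmxA.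
rewrite mulNmx !mulmxDl mulNmx mulmxDl !mulmxBr !mulmxBl.
by rewrite !(mxtraceD, raddfN) /= mxtraceD E !mulmxA; ring.
Qed.

End TraceIdentities.

(** * The ambient inner product and its derivative *)

Section Dot.
Context {R : realType} {N : nat}.
Implicit Types u v w : 'rV[R]_N.

Lemma dotv_mulmx u v : dotv u v = (u *m v^T) 0 0.
Proof. by rewrite mxE; apply: eq_bigr => i _; rewrite mxE. Qed.

Lemma dotvC u v : dotv u v = dotv v u.
Proof. by apply: eq_bigr => i _; rewrite mulrC. Qed.

Lemma dotvDl u v w : dotv (u + v) w = dotv u w + dotv v w.
Proof. by rewrite !dotv_mulmx mulmxDl mxE. Qed.

Lemma dotvBl u v w : dotv (u - v) w = dotv u w - dotv v w.
Proof. by rewrite !dotv_mulmx mulmxBl !mxE. Qed.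

Lemma dotv0l u : dotv 0 u = 0.
Proof. by rewrite dotv_mulmx mul0mx mxE. Qed.

Lemma dotv_suml (I : finType) (f : I -> 'rV[R]_N) u :
  dotv (\sum_i f i) u = \sum_i dotv (f i) u.
Proof.
by rewrite dotv_mulmx mulmx_suml summxE; apply: eq_bigr => i _;
  rewrite dotv_mulmx.
Qed.

End Dot.

Section DotDerivatives.
Context {R : realType} {V : normedModType R} {N : nat}.

Lemma differentiable_dotv (f g : V -> 'rV[R]_N) (x : V) :
  differentiable f x -> differentiable g x ->
  differentiable (fun y => dotv (f y) (g y)) x.
Proof.
move=> /differentiable_mxP df /differentiable_mxP dg.
by apply: differentiable_bigsum => i; exact: differentiable_mul.
Qed.

Lemma derive_dotv (f g : V -> 'rV[R]_N) (x v : V) :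
  differentiable f x -> differentiable g x ->
  'D_v (fun y => dotv (f y) (g y)) x =
  dotv ('D_v f x) (g x) + dotv (f x) ('D_v g x).
Proof.
move=> df dg.
have dfe k : differentiable (fun y => f y 0 k) x.
  by move/differentiable_mxP : df.
have dge k : differentiable (fun y => g y 0 k) x.
  by move/differentiable_mxP : dg.
rewrite derive_bigsum => [|k]; last exact/diff_derivable/differentiable_mul.
rewrite -big_split; apply: eq_bigr => k _ /=.
rewrite [LHS]deriveM; [|exact: diff_derivable..].
rewrite !derive_mxE; [|exact: diff_derivable..].
by rewrite /= addrC; congr (_ + _); exact: mulrC.
Qed.

End DotDerivatives.

(** * The second fundamental form in a chart *)

Section LocalGeometry.
Context {R : realType} {n N : nat}.
Variables (X : 'rV[R]_n -> 'rV[R]_N) (U : set 'rV[R]_n).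
Hypotheses (openU : open U) (smoothX : smooth_on U X).
Hypothesis unitG : forall y, U y -> gram X y \in unitmx.

Local Notation pd i := (pd R i).
Local Notation J := (jacobian X).
Local Notation Ginv y := (invmx (gram X y)).

Lemma near_chart x : U x -> \forall y \near x, U y.
Proof. by move=> Ux; apply: open_nbhs_nbhs. Qed.

Lemma differentiable_X x : U x -> differentiable X x.
Proof. by move=> Ux; exact: (smoothX [::] Ux). Qed.

Lemma differentiable_DX v x : U x -> differentiable ('D_v X) x.
Proof. by move=> Ux; exact: (smoothX [:: v] Ux). Qed.

Lemma differentiable_DDX u v x : U x -> differentiable ('D_u ('D_v X)) x.
Proof. by move=> Ux; exact: (smoothX [:: u; v] Ux). Qed.

Lemma derive_pd k (f : 'rV[R]_n -> 'rV[R]_k) v x : differentiable f x ->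
  'D_v f x = \sum_i v 0 i *: 'D_(pd i) f x.
Proof.
by move=> df; rewrite {1}(row_sum_delta v) derive_linear_combination.
Qed.

Lemma DXE v x : U x -> 'D_v X x = v *m J x.
Proof. by move=> Ux; rewrite deriveEjacobian//; exact: differentiable_X. Qed.

Lemma DDX_sym u v x : U x -> 'D_u ('D_v X) x = 'D_v ('D_u X) x.
Proof.
move=> Ux; apply: derive_comm_mx; [|exact: differentiable_DX..].
near=> y; apply: differentiable_X; near: y; exact: near_chart.
Unshelve. all: by end_near. Qed.

(** Linearity in the inner direction becomes linearity in the outer one once the two derivatives are
    exchanged. *)
Lemma DDX_pd u v x : U x ->
  'D_u ('D_v X) x = \sum_j v 0 j *: 'D_u ('D_(pd j) X) x.
Proof.
move=> Ux; rewrite [LHS](DDX_sym _ _ Ux) derive_pd.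
  apply: eq_bigr => j _.
  exact: (congr1 (fun z => v 0 j *: z) (DDX_sym (pd j) u Ux)).
exact: differentiable_DX.
Qed.

Lemma DDDX_sym w u v x : U x ->
  'D_w ('D_u ('D_v X)) x = 'D_u ('D_w ('D_v X)) x.
Proof.
move=> Ux; apply: derive_comm_mx; [|exact: differentiable_DDX..].
near=> y; apply: differentiable_DX; near: y; exact: near_chart.
Unshelve. all: by end_near. Qed.

Lemma DDDX_sym' w u v x : U x ->
  'D_w ('D_u ('D_v X)) x = 'D_w ('D_v ('D_u X)) x.
Proof.
move=> Ux; apply: near_eq_derive; near=> y; apply: DDX_sym.
near: y; exact: near_chart.
Unshelve. all: by end_near. Qed.

Lemma dot_DX w v x : U x -> dotv w ('D_v X x) = (w *m (J x)^T *m v^T) 0 0.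
Proof. by move=> Ux; rewrite dotv_mulmx (DXE _ Ux) trmx_mul mulmxA. Qed.

Lemma dot_DX_row w x : U x ->
  \row_l dotv w ('D_(pd l) X x) = w *m (J x)^T.
Proof.
move=> Ux; apply/rowP => l; rewrite mxE (dot_DX _ _ Ux) /Defs.pd trmx_delta.
by rewrite -colE mxE.
Qed.

Lemma gramE x : U x -> gram X x = J x *m (J x)^T.
Proof.
move=> Ux; apply/matrixP => i j; rewrite mxE /metric (dot_DX _ _ Ux) (DXE _ Ux).
by rewrite /Defs.pd trmx_delta -colE mxE -!mulmxA -rowE mxE.
Qed.

Lemma gram_sym x : U x -> (gram X x)^T = gram X x.
Proof. by move=> Ux; rewrite (gramE Ux) trmx_mul trmxK. Qed.

Lemma metricE u v x : U x -> metric X u v x = (u *m gram X x *m v^T) 0 0.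
Proof.
by move=> Ux; rewrite /metric (dot_DX _ _ Ux) (DXE _ Ux) (gramE Ux) !mulmxA.
Qed.

Lemma normal_partE w x : U x ->
  normal_part X x w = w - w *m (J x)^T *m Ginv x *m J x.
Proof. by move=> Ux; rewrite /normal_part (dot_DX_row _ Ux) DXE. Qed.

(** Here and below [nu *m (J x)^T = 0] says that [nu] is normal at [x]. *)
Lemma normal_part_dot w nu x : U x -> nu *m (J x)^T = 0 ->
  dotv (normal_part X x w) nu = dotv w nu.
Proof.
move=> Ux nuJ; have Jnu : J x *m nu^T = 0.
  by rewrite -[J x]trmxK -trmx_mul nuJ trmx0.
by rewrite !dotv_mulmx (normal_partE _ Ux) mulmxBl -!mulmxA Jnu !mulmx0 subr0.
Qed.

Lemma normal_part_orth w x : U x -> normal_part X x w *m (J x)^T = 0.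
Proof.
move=> Ux; rewrite (normal_partE _ Ux) mulmxBl -!mulmxA -(gramE Ux).
by rewrite mulVmx ?unitG// mulmx1 subrr.
Qed.

Lemma sff_orth u v x : U x -> sff X u v x *m (J x)^T = 0.
Proof. exact: normal_part_orth. Qed.

Lemma sff_dot u v nu x : U x -> nu *m (J x)^T = 0 ->
  dotv (sff X u v x) nu = dotv ('D_u ('D_v X) x) nu.
Proof. exact: normal_part_dot. Qed.

Lemma normal_part_lincomb (I : finType) (a : I -> R) (w : I -> 'rV[R]_N) x :
  U x -> normal_part X x (\sum_i a i *: w i)
  = \sum_i a i *: normal_part X x (w i).
Proof.
move=> Ux; rewrite (normal_partE _ Ux) !mulmx_suml -sumrB.
by apply: eq_bigr => i _; rewrite (normal_partE _ Ux) scalerBr -!scalemxAl.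
Qed.

Lemma sff_sym u v x : U x -> sff X u v x = sff X v u x.
Proof. by move=> Ux; exact: (congr1 (normal_part X x) (DDX_sym u v Ux)). Qed.

Lemma sff_pdr u v x : U x ->
  sff X u v x = \sum_j v 0 j *: sff X u (pd j) x.
Proof.
move=> Ux; rewrite -(normal_part_lincomb _ _ Ux); congr (normal_part X x _).
exact: DDX_pd.
Qed.

(** Ambient coordinates replace the normal frame: frames are arbitrary pointwise choices, whereas
    these matrices can be differentiated. *)
Definition sffmx t y : 'M[R]_n := \matrix_(i, j) sff X (pd i) (pd j) y 0 t.

Lemma sffmxE t y i j : sffmx t y i j = sff X (pd i) (pd j) y 0 t.
Proof. exact: mxE. Qed.

Lemma sffmx_sym t x : U x -> (sffmx t x)^T = sffmx t x.
Proof.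
move=> Ux; apply/matrixP => i j; rewrite [LHS]mxE !sffmxE.
exact: (congr1 (fun w : 'rV_N => w 0 t) (sff_sym _ _ Ux)).
Qed.

Lemma sff_pd_coord t u v x : U x ->
  sff X u v x 0 t = \sum_j v 0 j * sff X u (pd j) x 0 t.
Proof.
move=> Ux; rewrite [in LHS](sff_pdr u v Ux) summxE.
by apply: eq_bigr => j _; rewrite [LHS]mxE.
Qed.

Lemma sff_coord t u v x : U x ->
  sff X u v x 0 t = (u *m sffmx t x *m v^T) 0 0.
Proof.
move=> Ux; rewrite (sff_pd_coord t u v Ux) [RHS]mxE; apply: eq_bigr => j _.
rewrite [v^T _ _]mxE mulrC; congr (_ * _).
rewrite (sff_sym u (pd j) Ux) (sff_pd_coord t (pd j) u Ux) [RHS]mxE.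
apply: eq_bigr => i _; congr (_ * _); rewrite sffmxE.
exact: (congr1 (fun w : 'rV_N => w 0 t) (sff_sym _ _ Ux)).
Qed.

(** * Derivatives of the Jacobian, the metric and the second fundamental form *)

Lemma differentiable_jacobian x : U x -> differentiable J x.
Proof.
move=> Ux; apply/differentiable_mxP => i t.
apply: (@near_eq_differentiable _ _ _ (fun y => 'D_(pd i) X y 0 t)).
  near=> y; have Uy : U y by near: y; exact: near_chart.
  by rewrite (DXE _ Uy) /Defs.pd -rowE mxE.
by have /differentiable_mxP := differentiable_DX (pd i) Ux.
Unshelve. all: by end_near. Qed.

Lemma derive_jacobian c w x : U x ->
  c *m 'D_w J x = 'D_w ('D_c X) x.
Proof.
move=> Ux; transitivity ('D_w (fun y => cst c y *m J y) x).
  rewrite derive_mulmx; last exact: differentiable_jacobian.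
    by rewrite derive_cst mul0mx add0r.
  exact: differentiable_cst.
apply: near_eq_derive; near=> y; have Uy : U y by near: y; exact: near_chart.
exact: esym (DXE c Uy).
Unshelve. all: by end_near. Qed.

Lemma differentiable_gram x : U x -> differentiable (gram X) x.
Proof.
move=> Ux; apply/differentiable_mxP => i j.
rewrite (_ : (fun _ => _) = metric X (pd i) (pd j)); last first.
  by apply/funext => y; rewrite mxE.
by apply: differentiable_dotv; exact: differentiable_DX.
Qed.

Lemma near_unit_gram x : U x -> \forall y \near x, gram X y \in unitmx.
Proof.
by move=> Ux; near=> y; apply: unitG; near: y; exact: near_chart.
Unshelve. all: by end_near. Qed.

Lemma differentiable_Ginv x : U x -> differentiable (fun y => Ginv y) x.
Proof.
move=> Ux; apply/differentiable_mxP; apply: differentiable_invmx.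
  exact: near_unit_gram.
exact/differentiable_mxP/differentiable_gram.
Qed.

Lemma derive_metric w u v x : U x ->
  'D_w (metric X u v) x
  = dotv ('D_w ('D_u X) x) ('D_v X x) + dotv ('D_w ('D_v X) x) ('D_u X x).
Proof.
move=> Ux; rewrite /metric derive_dotv; [|exact: differentiable_DX..].
by rewrite (dotvC ('D_u X x)).
Qed.

(* The Koszul formula gives the tangential part of the flat derivative. *)
Lemma levi_civitaE u v x : U x ->
  levi_civita X u v x = 'D_u ('D_v X) x *m (J x)^T *m Ginv x.
Proof.
move=> Ux; rewrite /levi_civita -(dot_DX_row _ Ux); congr (_ *m _).
apply/rowP => l; rewrite [LHS]mxE [RHS]mxE.
(* Here and below equations are combined through auxiliary congruences:
   rewriting would compare derivatives of X in different directions by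
   unfolding limits, which is hopelessly slow. *)
have koszul (A B C p q r : R) :
    A = p + q -> B = p + r -> C = q + r -> 2^-1 * (A + B - C) = p.
  by move=> -> -> ->; field.
apply: koszul.
- exact: derive_metric.
- exact: etrans (derive_metric v u (pd l) Ux)
    (congr1 (fun z => dotv z ('D_(pd l) X x) + _) (DDX_sym v u Ux)).
- rewrite [LHS](derive_metric (pd l) u v Ux).
  have congr_dotvD (a b c d p q : 'rV[R]_N) :
    a = b -> c = d -> dotv a p + dotv c q = dotv b p + dotv d q by move=> -> ->.
  exact: (congr_dotvD _ _ _ _ _ _ (DDX_sym _ _ Ux) (DDX_sym _ _ Ux)).
Qed.

Lemma levi_civita_sym u v x : U x -> levi_civita X u v x = levi_civita X v u x.
Proof.
move=> Ux; rewrite [LHS](levi_civitaE _ _ Ux) [RHS](levi_civitaE _ _ Ux).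
exact: (congr1 (fun z => z *m _ *m _) (DDX_sym u v Ux)).
Qed.

(** The Gauss formula; it is the form in which [sff] gets differentiated. *)
Lemma sff_gauss u v x : U x ->
  sff X u v x = 'D_u ('D_v X) x - levi_civita X u v x *m J x.
Proof. by move=> Ux; rewrite /sff (normal_partE _ Ux) levi_civitaE. Qed.

(** The connection matrix with entries w^k Gamma^j_ki; vectors are rows, so it acts from the
    right. *)
Definition christoffel w y : 'M[R]_n := \matrix_i levi_civita X w (pd i) y.

Lemma christoffelE w u x : U x -> levi_civita X w u x = u *m christoffel w x.
Proof.
move=> Ux; rewrite [LHS](levi_civitaE _ _ Ux) [in LHS](DDX_pd w u Ux).
rewrite !mulmx_suml mulmx_sum_row; apply: eq_bigr => i _.
by rewrite rowK (levi_civitaE _ _ Ux) -!scalemxAl.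
Qed.

(** Metric compatibility: the entries of C G are the products of D_w D_i X with D_j X. *)
Lemma derive_gram w x : U x ->
  'D_w (gram X) x
  = christoffel w x *m gram X x + gram X x *m (christoffel w x)^T.
Proof.
move=> Ux.
have GG : gram X x *m (christoffel w x)^T = (christoffel w x *m gram X x)^T.
  by rewrite trmx_mul gram_sym.
have chG i j : (christoffel w x *m gram X x) i j =
    dotv ('D_w ('D_(pd i) X) x) ('D_(pd j) X x).
  transitivity (row i (christoffel w x *m gram X x) 0 j).
    by rewrite [RHS]mxE.
  rewrite row_mul rowK (levi_civitaE _ _ Ux) -!mulmxA mulVmx ?unitG// mulmx1.
  by rewrite -(dot_DX_row _ Ux) mxE.
apply/matrixP => i j; rewrite derive_mxE; last first.
  exact/diff_derivable/differentiable_gram.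
rewrite GG [RHS]mxE [X in _ + X]mxE (chG i j) (chG j i).
rewrite -[RHS](derive_metric w (pd i) (pd j) Ux).
by congr ('D_w _ x); apply/funext => y; rewrite mxE.
Qed.

Lemma differentiable_levi_civita u v x : U x ->
  differentiable (levi_civita X u v) x.
Proof.
move=> Ux.
apply: (@near_eq_differentiable _ _ _
    (fun y => 'D_u ('D_v X) y *m (J y)^T *m Ginv y)).
  near=> y; have Uy : U y by near: y; exact: near_chart.
  exact: esym (levi_civitaE u v Uy).
apply: differentiable_mulmx; last exact: differentiable_Ginv.
apply: differentiable_mulmx; first exact: differentiable_DDX.
exact/differentiable_trmx/differentiable_jacobian.
Unshelve. all: by end_near. Qed.

Lemma near_sff_gauss u v x : U x -> \forall y \near x,
  'D_u ('D_v X) y - levi_civita X u v y *m J y = sff X u v y.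
Proof.
move=> Ux; near=> y; have Uy : U y by near: y; exact: near_chart.
exact: esym (sff_gauss u v Uy).
Unshelve. all: by end_near. Qed.

Lemma differentiable_lcJ u v x : U x ->
  differentiable (fun y => levi_civita X u v y *m J y) x.
Proof.
move=> Ux; apply: differentiable_mulmx.
  exact: differentiable_levi_civita.
exact: differentiable_jacobian.
Qed.

Lemma differentiable_sff u v x : U x -> differentiable (sff X u v) x.
Proof.
move=> Ux; apply: near_eq_differentiable (near_sff_gauss u v Ux) _.
apply: (@differentiableB _ _ _ ('D_u ('D_v X))
  (fun y => levi_civita X u v y *m J y)).
  exact: differentiable_DDX.
exact: differentiable_lcJ.
Qed.

(** The product rule on the Gauss formula. In the last term the direction [levi_civita X u v x] is
    frozen at [x], so that its normal part is a value of [sff]. *)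
Lemma derive_sff w u v x : U x ->
  'D_w (sff X u v) x = 'D_w ('D_u ('D_v X)) x
    - ('D_w (levi_civita X u v) x *m J x
       + 'D_w ('D_(levi_civita X u v x) X) x).
Proof.
move=> Ux; rewrite -(near_eq_derive _ (near_sff_gauss u v Ux)).
rewrite -(derive_jacobian _ _ Ux) -derive_mulmx; last 2 first.
- exact: differentiable_levi_civita.
- exact: differentiable_jacobian.
rewrite [LHS](@deriveB _ _ _ ('D_u ('D_v X))
  (fun y => levi_civita X u v y *m J y))//.
  exact/diff_derivable/differentiable_DDX.
exact/diff_derivable/differentiable_lcJ.
Qed.

(* [nabla_sff] without the normal projection of the derivative of [sff], which
   does not change the normal components. *)
Definition nabla_sff_flat w u v x :=
  'D_w (sff X u v) x - sff X (levi_civita X w u x) v x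
  - sff X u (levi_civita X w v x) x.

(** * Normal components of nabla B and the Codazzi equation *)

Lemma dotvB3 (a b c d : 'rV[R]_N) :
  dotv (a - b - c) d = dotv a d - dotv b d - dotv c d.
Proof. by rewrite !dotvBl. Qed.

Lemma nabla_sff_dot w u v nu x : U x -> nu *m (J x)^T = 0 ->
  dotv (nabla_sff X w u v x) nu = dotv (nabla_sff_flat w u v x) nu.
Proof.
move=> Ux nuJ; rewrite [LHS]dotvB3 [RHS]dotvB3.
have H (a b : R) : a = b -> forall c d, a - c - d = b - c - d by move=> ->.
exact: (H _ _ (normal_part_dot _ Ux nuJ)).
Qed.

Lemma derive_sff_dot w u v nu x : U x -> nu *m (J x)^T = 0 ->
  dotv ('D_w (sff X u v) x) nu = dotv ('D_w ('D_u ('D_v X)) x) nu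
    - dotv (sff X w (levi_civita X u v x) x) nu.
Proof.
move=> Ux nuJ; rewrite [in LHS](derive_sff w u v Ux) [LHS]dotvBl.
congr (_ - _); rewrite [RHS](sff_dot _ _ Ux nuJ) [LHS]dotvDl.
rewrite [X in X + _]dotv_mulmx -mulmxA.
have -> : J x *m nu^T = 0 by rewrite -[J x]trmxK -trmx_mul nuJ trmx0.
by rewrite mulmx0 mxE add0r.
Qed.

(** A third derivative of X minus three correction terms, an expression symmetric in all three
    directions; both symmetries of nabla B are read off from it. *)
Lemma nabla_sff_dotE w u v nu x : U x -> nu *m (J x)^T = 0 ->
  dotv (nabla_sff X w u v x) nu =
  dotv ('D_w ('D_u ('D_v X)) x) nu
  - dotv (sff X w (levi_civita X u v x) x) nu
  - dotv (sff X v (levi_civita X w u x) x) nu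
  - dotv (sff X u (levi_civita X w v x) x) nu.
Proof.
move=> Ux nuJ; rewrite [LHS](nabla_sff_dot _ _ _ Ux nuJ) [LHS]dotvB3.
have H (a b c d : R) : a = b -> c = d -> forall e, a - c - e = b - d - e.
  by move=> -> ->.
have S (a b : 'rV[R]_N) : a = b -> dotv a nu = dotv b nu by move=> ->.
exact: (H _ _ _ _ (derive_sff_dot w u v Ux nuJ) (S _ _ (sff_sym _ _ Ux))).
Qed.

(** The flat ambient connection enters through the symmetry of third derivatives, the induced one
    through its vanishing torsion. *)
Lemma codazzi w u v nu x : U x -> nu *m (J x)^T = 0 ->
  dotv (nabla_sff X w u v x) nu = dotv (nabla_sff X v u w x) nu.
Proof.
move=> Ux nuJ.
have e1 := nabla_sff_dotE w u v Ux nuJ.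
have e2 := nabla_sff_dotE v u w Ux nuJ.
have e3 : 'D_w ('D_u ('D_v X)) x = 'D_v ('D_u ('D_w X)) x.
  apply: etrans (DDDX_sym w u v Ux) _; apply: etrans (DDDX_sym' u w v Ux) _.
  exact: (DDDX_sym u v w Ux).
have S (a b : 'rV[R]_N) : a = b -> dotv a nu = dotv b nu by move=> ->.
have S' (a b c : 'rV[R]_n) : b = c ->
    dotv (sff X a b x) nu = dotv (sff X a c x) nu by move=> ->.
have L a b c : dotv (sff X a (levi_civita X b c x) x) nu =
    dotv (sff X a (levi_civita X c b x) x) nu.
  exact: (S' _ _ _ (levi_civita_sym b c Ux)).
(* Exchanging [w] and [v] swaps the first two corrections and fixes the third, up to
   [levi_civita_sym]. *)
have H (A B T1 p1 q1 r1 T2 p2 q2 r2 : R) :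
    A = T1 - p1 - q1 - r1 -> B = T2 - p2 - q2 - r2 ->
    T1 = T2 -> p1 = q2 -> q1 = p2 -> r1 = r2 -> A = B.
  by move=> -> -> -> -> -> ->; ring.
exact: (H _ _ _ _ _ _ _ _ _ _ e1 e2 (S _ _ e3) (L w u v) (L v w u) (L u w v)).
Qed.

Lemma nabla_sff_sym w u v nu x : U x -> nu *m (J x)^T = 0 ->
  dotv (nabla_sff X w u v x) nu = dotv (nabla_sff X w v u x) nu.
Proof.
move=> Ux nuJ.
have e1 := nabla_sff_dotE w u v Ux nuJ.
have e2 := nabla_sff_dotE w v u Ux nuJ.
have S (a b : 'rV[R]_N) : a = b -> dotv a nu = dotv b nu by move=> ->.
have S' (a b c : 'rV[R]_n) : b = c ->
    dotv (sff X a b x) nu = dotv (sff X a c x) nu by move=> ->.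
have L : dotv (sff X w (levi_civita X u v x) x) nu =
    dotv (sff X w (levi_civita X v u x) x) nu.
  exact: (S' _ _ _ (levi_civita_sym u v Ux)).
have H (A B T1 p1 q1 r1 T2 p2 : R) :
    A = T1 - p1 - q1 - r1 -> B = T2 - p2 - r1 - q1 ->
    T1 = T2 -> p1 = p2 -> A = B.
  by move=> -> -> -> ->; ring.
exact: (H _ _ _ _ _ _ _ _ e1 e2 (S _ _ (DDDX_sym' w u v Ux)) L).
Qed.

(** * Covariant derivatives in matrix form *)

Lemma differentiable_sffmx t x : U x -> differentiable (sffmx t) x.
Proof.
move=> Ux; apply/differentiable_mxP => i j.
rewrite (_ : (fun _ => _) = fun y => sff X (pd i) (pd j) y 0 t); last first.
  by apply/funext => y; rewrite mxE.
by have /differentiable_mxP := differentiable_sff (pd i) (pd j) Ux.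
Qed.

(** The covariant derivative of a scalar bilinear form: the ambient index [t] is differentiated by
    the flat connection, matching [nabla_sff_flat]. *)
Definition nabla_mx w t x : 'M[R]_n :=
  'D_w (sffmx t) x - christoffel w x *m sffmx t x
  - sffmx t x *m (christoffel w x)^T.

Lemma nabla_sff_flat_coord w t u v x : U x ->
  nabla_sff_flat w u v x 0 t = (u *m nabla_mx w t x *m v^T) 0 0.
Proof.
move=> Ux.
have sub3 k (a b c : 'rV[R]_k) i : (a - b - c) 0 i = a 0 i - b 0 i - c 0 i.
  by rewrite !mxE.
have congr3 (a b c a' b' c' : R) :
    a = a' -> b = b' -> c = c' -> a - b - c = a' - b' - c'.
  by move=> -> -> ->.
rewrite [LHS]sub3 /nabla_mx !mulmxBr !mulmxBl [RHS]sub3; apply: congr3.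
- rewrite [LHS]derive_mxE; last exact/diff_derivable/differentiable_sff.
  rewrite -(derive_mulmx_cst u v^T w (differentiable_sffmx t Ux)).
  rewrite [RHS]derive_mxE; last first.
    apply/diff_derivable/differentiable_mulmx; last exact: differentiable_cst.
    apply: differentiable_mulmx; first exact: differentiable_cst.
    exact: differentiable_sffmx.
  apply: near_eq_derive; near=> y; have Uy : U y by near: y; exact: near_chart.
  exact: sff_coord.
- by rewrite [LHS](sff_coord t _ _ Ux) (christoffelE w u Ux) !mulmxA.
- by rewrite [LHS](sff_coord t _ _ Ux) (christoffelE w v Ux) trmx_mul !mulmxA.
Unshelve. all: by end_near. Qed.

Lemma mean_curvature_coord t x :
  mean_curvature X x 0 t = \tr (Ginv x *m (sffmx t x)^T).
Proof.
rewrite /mean_curvature /mxtrace summxE; apply: eq_bigr => i _.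
by rewrite summxE mxE; apply: eq_bigr => j _; rewrite !mxE.
Qed.

Lemma derive_Ginv w x : U x ->
  'D_w (fun y => Ginv y) x
  = - (Ginv x *m christoffel w x + (christoffel w x)^T *m Ginv x).
Proof.
move=> Ux; rewrite derive_invmx//; last 2 first.
- exact: near_unit_gram.
- exact: differentiable_gram.
rewrite (derive_gram _ Ux) mulmxDr mulmxDl; congr (- (_ + _)).
  by rewrite -!mulmxA mulmxV ?unitG// mulmx1.
by rewrite mulKmx// unitG.
Qed.

(** Minimality holds on all of [U], so the mean curvature can be differentiated; the result is the
    trace of the covariant derivative. *)
Lemma derive_mean_curvature t w x : U x ->
  (forall y, U y -> mean_curvature X y = 0) ->
  \tr (nabla_mx w t x *m Ginv x) = 0.
Proof.
move=> Ux H0.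
have dGi := differentiable_Ginv Ux; have db := differentiable_sffmx t Ux.
transitivity ('D_w (fun y => \tr (Ginv y *m sffmx t y)) x); last first.
  rewrite (near_eq_derive (g := cst 0)) ?derive_cst//.
  near=> y; have Uy : U y by near: y; exact: near_chart.
  by rewrite -[sffmx t y](sffmx_sym _ Uy) -mean_curvature_coord H0// mxE.
rewrite derive_mxtrace; last exact: differentiable_mulmx.
by rewrite derive_mulmx// (derive_Ginv _ Ux) mxtrace_covariant1.
Unshelve. all: by end_near. Qed.

Lemma derive_sff_norm2 t w x : U x ->
  'D_w (fun y => \tr (Ginv y *m sffmx t y *m (Ginv y *m sffmx t y))) x
  = 2 * \tr (Ginv x *m nabla_mx w t x *m (Ginv x *m sffmx t x)).
Proof.
move=> Ux.
have dGi := differentiable_Ginv Ux; have db := differentiable_sffmx t Ux.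
have dGb : differentiable (fun y => Ginv y *m sffmx t y) x.
  exact: differentiable_mulmx.
rewrite derive_mxtrace; last exact: differentiable_mulmx.
(* Cyclicity makes the two terms of the product rule equal. *)
rewrite derive_mulmx// mxtraceD [X in _ + X]mxtrace_mulC -mulr2n.
rewrite -[LHS]mulr_natl.
congr (_ * _); rewrite derive_mulmx// (derive_Ginv _ Ux).
exact: mxtrace_covariant2.
Qed.

End LocalGeometry.

(** * Orthonormal frames *)

Section FrameAlgebra.
Context {R : realType}.

Lemma mulmx_trE k l p (A : 'M[R]_(k, p)) (B : 'M[R]_(l, p)) i j :
  (A *m B^T) i j = dotv (row i A) (row j B).
Proof. by rewrite mxE; apply: eq_bigr => s _; rewrite !mxE. Qed.

(** With the frame vectors as the rows of [E], this turns sums over the frame into contractions with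
    the inverse Gram matrix. *)
Lemma frame_gram_inv n (E G : 'M[R]_n) : E *m G *m E^T = 1%:M ->
  G \in unitmx /\ invmx G = E^T *m E.
Proof.
move=> EGE; have [EGu Etu] := mulmx1_unit EGE.
move: EGu; rewrite unitmx_mul => /andP[Eu Gu]; split=> //.
have GEE : G *m (E^T *m E) = 1%:M.
  have EE : E *m (G *m (E^T *m E)) = E by rewrite !mulmxA EGE mul1mx.
  by rewrite -[LHS](mulKmx Eu) EE mulVmx.
by rewrite -[RHS](mulKmx Gu) GEE mulmx1.
Qed.

Lemma frame_contraction n (E S T : 'M[R]_n) :
  \sum_i \sum_j (row i E *m S *m (row j E)^T) 0 0
    * (row i E *m T *m (row j E)^T) 0 0
  = \tr (E^T *m E *m S *m (E^T *m E *m T^T)).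
Proof.
have ES A i j : (row i E *m A *m (row j E)^T) 0 0 = (E *m A *m E^T) i j.
  by rewrite [RHS]mulmx_trE row_mul dotv_mulmx.
transitivity (\tr (E *m S *m E^T *m (E *m T *m E^T)^T)).
  apply: eq_bigr => i _; rewrite [RHS]mxE; apply: eq_bigr => j _.
  by rewrite !ES [_^T j i]mxE.
by rewrite !trmx_mul trmxK !mulmxA [LHS]mxtrace_mulC !mulmxA.
Qed.

(** The rows of [Nu] and [T] form an orthonormal basis of the ambient space, and the coordinates of
    [z] along [T] vanish. *)
Lemma parseval_normal m n (Nu : 'M[R]_(m, m + n)) (T : 'M[R]_(n, m + n))
    (w z : 'rV[R]_(m + n)) :
  Nu *m Nu^T = 1%:M -> Nu *m T^T = 0 -> T *m T^T = 1%:M -> z *m T^T = 0 ->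
  \sum_a dotv w (row a Nu) * dotv z (row a Nu) = dotv w z.
Proof.
move=> NN NT TT zT; have TN : T *m Nu^T = 0.
  by rewrite -[T]trmxK -trmx_mul NT trmx0.
have : col_mx Nu T *m (col_mx Nu T)^T = 1%:M.
  by rewrite tr_col_mx mul_col_row NN NT TN TT -scalar_mx_block.
(* For a square matrix, orthonormal rows give the resolution of the identity. *)
move=> /mulmx1C; rewrite tr_col_mx mul_row_col => O1.
have Tz : T *m z^T = 0 by rewrite -[T]trmxK -trmx_mul zT trmx0.
have wz : w *m z^T = w *m Nu^T *m (z *m Nu^T)^T.
  rewrite -{1}[w]mulmx1 -O1 mulmxDr mulmxDl -!mulmxA Tz !mulmx0 addr0.
  by rewrite trmx_mul trmxK.
rewrite [RHS]dotv_mulmx wz [RHS]mulmx_trE.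
have rid k (A : 'rV[R]_k) : row 0 A = A by apply/rowP => i; rewrite mxE.
by rewrite !rid; apply: eq_bigr => a _; rewrite !mulmx_trE !rid.
Qed.

End FrameAlgebra.

(** * From frame components to traces, and the inequality in a chart *)

Section Frames.
Context {R : realType} {n m : nat}.
Variables (X : 'rV[R]_n -> 'rV[R]_(m + n)) (U : set 'rV[R]_n).
Hypotheses (openU : open U) (smoothX : smooth_on U X).
Variables (e : 'I_n -> 'rV[R]_n -> 'rV[R]_n)
  (nu : 'I_m -> 'rV[R]_n -> 'rV[R]_(m + n)).
Hypotheses (tfr : orthonormal_tangent_frame X U e)
  (nfr : orthonormal_normal_frame X U nu).

Local Notation J := (jacobian X).
Let E y : 'M[R]_n := \matrix_i e i y.
Let Nu y : 'M[R]_(m, m + n) := \matrix_a nu a y.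

Lemma frame_gram y : U y -> E y *m gram X y *m (E y)^T = 1%:M.
Proof.
move=> Uy; apply/matrixP => i j; rewrite mulmx_trE row_mul !rowK.
have := tfr Uy i j; rewrite (metricE smoothX _ _ Uy) -dotv_mulmx => ->.
by rewrite mxE.
Qed.

Lemma gram_unitmx y : U y -> gram X y \in unitmx.
Proof. by move=> /frame_gram/frame_gram_inv[]. Qed.

Lemma invmx_gram y : U y -> invmx (gram X y) = (E y)^T *m E y.
Proof. by move=> /frame_gram/frame_gram_inv[]. Qed.

Lemma nu_orth a y : U y -> nu a y *m (J y)^T = 0.
Proof.
move=> Uy; rewrite -(dot_DX_row smoothX _ Uy); apply/rowP => l.
by rewrite mxE (nfr Uy).2 mxE.
Qed.

Lemma sum_nu w z y : U y -> z *m (J y)^T = 0 ->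
  \sum_a dotv w (nu a y) * dotv z (nu a y) = dotv w z.
Proof.
move=> Uy zJ.
(* The rows of [E y *m J y] are the tangent vectors dX(e_i). *)
rewrite -(@parseval_normal _ _ _ (Nu y) (E y *m J y) w z).
- by apply: eq_bigr => a _; rewrite rowK.
- apply/matrixP => a b; rewrite mulmx_trE !rowK (nfr Uy).1 mxE //.
- apply/matrixP => a b.
  by rewrite trmx_mul mulmxA mulmx_trE row_mul rowK nu_orth// dotv0l mxE.
- rewrite trmx_mul mulmxA -(mulmxA (E y)) -(gramE smoothX Uy).
  exact: frame_gram.
- by rewrite trmx_mul mulmxA zJ mul0mx.
Qed.

Let b y a i j := dotv (sff X (e i y) (e j y) y) (nu a y).
Let h y a i j k := dotv (nabla_sff X (e k y) (e i y) (e j y) y) (nu a y).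

Let unitG := gram_unitmx.

(** B is normal, so the sum over [nu] is an ambient inner product; the sums over [e] then contract
    with the inverse Gram matrix. It is applied to B itself and to its flat covariant derivative. *)
Lemma sum_sff_nu (S : 'I_(m + n) -> 'M[R]_n)
    (g : 'I_n -> 'I_n -> 'rV[R]_(m + n)) y : U y ->
  (forall i j t, g i j 0 t = (e i y *m S t *m (e j y)^T) 0 0) ->
  \sum_a \sum_i \sum_j b y a i j * dotv (g i j) (nu a y)
  = \sum_t \tr (invmx (gram X y) *m S t *m (invmx (gram X y) *m sffmx X t y)).
Proof.
move=> Uy gE.
transitivity (\sum_i \sum_j dotv (g i j) (sff X (e i y) (e j y) y)).
  rewrite exchange_big; apply: eq_bigr => i _.
  rewrite exchange_big; apply: eq_bigr => j _.
  rewrite -(sum_nu (g i j) Uy (sff_orth smoothX unitG _ _ Uy)).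
  by apply: eq_bigr => a _; exact: mulrC.
rewrite (invmx_gram Uy).
transitivity (\sum_t \sum_i \sum_j g i j 0 t * sff X (e i y) (e j y) y 0 t).
  rewrite [RHS]exchange_big; apply: eq_bigr => i _.
  by rewrite [RHS]exchange_big; apply: eq_bigr => j _.
apply: eq_bigr => t _.
rewrite -[X in _ *m (_ *m X)](sffmx_sym openU smoothX t Uy).
rewrite -frame_contraction; apply: eq_bigr => i _; apply: eq_bigr => j _.
by rewrite !rowK gE (sff_coord openU smoothX t _ _ Uy).
Qed.

(** A frame-free form of |B|^2, differentiable even where the frames are not. *)
Let norm2 y := \sum_t
  \tr (invmx (gram X y) *m sffmx X t y *m (invmx (gram X y) *m sffmx X t y)).

Lemma sum_sqr_sff y : U y ->
  \sum_a \sum_i \sum_j b y a i j ^+ 2 = norm2 y.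
Proof.
move=> Uy.
rewrite -[RHS](@sum_sff_nu _ (fun i j => sff X (e i y) (e j y) y) _ Uy).
  by do 3!(apply: eq_bigr => ? _); exact: expr2.
by move=> i j t; exact: (sff_coord openU smoothX t _ _ Uy).
Qed.

Lemma sff_norm_sqr y : U y -> sff_norm X e nu y ^+ 2 = norm2 y.
Proof.
move=> Uy; rewrite -(sum_sqr_sff Uy); apply: sqr_sqrtr.
by do 3!(apply: sumr_ge0 => ? _); exact: sqr_ge0.
Qed.

Lemma differentiable_norm2_coord t x : U x -> differentiable (fun y =>
  \tr (invmx (gram X y) *m sffmx X t y
       *m (invmx (gram X y) *m sffmx X t y))) x.
Proof.
move=> Ux.
have dGb : differentiable (fun y => invmx (gram X y) *m sffmx X t y) x.
  apply: differentiable_mulmx; first exact: (differentiable_Ginv openU smoothX).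
  exact: (differentiable_sffmx openU smoothX).
exact/differentiable_mxtrace/differentiable_mulmx.
Qed.

Lemma differentiable_norm2 x : U x -> differentiable norm2 x.
Proof.
move=> Ux; apply: differentiable_bigsum => t.
exact: differentiable_norm2_coord.
Qed.

(** The sum on the right is T_k, so that T is half the gradient of |B|^2. *)
Lemma derive_norm2 k x : U x ->
  'D_(e k x) norm2 x = 2 * \sum_a \sum_i \sum_j b x a i j * h x a i j k.
Proof.
move=> Ux; have dt t := differentiable_norm2_coord t Ux.
rewrite derive_bigsum => [|t]; last exact: diff_derivable.
under eq_bigr => t _ do rewrite (derive_sff_norm2 openU smoothX unitG _ _ Ux).
rewrite -mulr_sumr; congr (_ * _).
rewrite -(@sum_sff_nu (fun t => nabla_mx X (e k x) t x)
  (fun i j => nabla_sff_flat X (e k x) (e i x) (e j x) x) _ Ux).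
  do 3!(apply: eq_bigr => ? _); congr (_ * _).
  exact: esym (nabla_sff_dot smoothX _ _ _ Ux (nu_orth _ Ux)).
move=> i j t; exact: (nabla_sff_flat_coord openU smoothX unitG).
Qed.

Hypothesis minX : forall y, U y -> mean_curvature X y = 0.

(** Each ambient coordinate of the traced flat derivative vanishes by [derive_mean_curvature]. *)
Lemma nabla_sff_traceless a k x : U x -> \sum_i h x a i i k = 0.
Proof.
move=> Ux; transitivity
    (dotv (\sum_i nabla_sff_flat X (e k x) (e i x) (e i x) x) (nu a x)).
  rewrite dotv_suml; apply: eq_bigr => i _.
  exact: (nabla_sff_dot smoothX _ _ _ Ux (nu_orth _ Ux)).
rewrite (_ : \sum_i _ = 0) ?dotv0l//; apply/rowP => t.
rewrite summxE [RHS]mxE.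
rewrite -[RHS](derive_mean_curvature openU smoothX unitG t (e k x) Ux minX).
rewrite (invmx_gram Ux) mulmxA [RHS]mxtrace_mulC mulmxA.
apply: eq_bigr => i _.
rewrite (nabla_sff_flat_coord openU smoothX unitG _ _ _ _ Ux).
by rewrite [RHS]mulmx_trE row_mul rowK dotv_mulmx.
Qed.

Lemma kato_chart x : (0 < n)%N -> (0 < m)%N -> U x ->
  let normB := sff_norm X e nu in
  (normB x != 0 -> differentiable normB x) /\
  (differentiable normB x ->
     nabla_sff_norm2 X e nu x >=
       (1 + 2 / (m%:R * n%:R)) * grad_norm2 e normB x).
Proof.
move=> n0 m0 Ux normB.
have nE : \forall y \near x, normB y ^+ 2 = norm2 y.
  near=> y; apply: sff_norm_sqr; near: y; exact: open_nbhs_nbhs.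
have normB0 y : 0 <= normB y by exact: sqrtr_ge0.
split=> [nB0|dB].
  have norm2_gt0 : 0 < norm2 x.
    by rewrite -(sff_norm_sqr Ux) exprn_gt0// lt0r nB0 normB0.
  (* |B| is the square root of [norm2], which is positive at [x]. *)
  apply: (@near_eq_differentiable _ _ _ (Num.sqrt \o norm2)).
    near=> y; have Uy : U y by near: y; exact: open_nbhs_nbhs.
    by rewrite /= -(sff_norm_sqr Uy) sqrtr_sqr ger0_norm.
  apply: differentiable_comp; first exact: differentiable_norm2.
  apply/derivable1_diffP.
  have [] := is_derive1_sqrt norm2_gt0 => //.
(* Differentiating |B|^2 = [norm2] on both sides gives |B| D_k |B| = T_k. *)
have dk k : normB x * 'D_(e k x) normB x
    = \sum_a \sum_i \sum_j b x a i j * h x a i j k.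
  apply: (@mulfI R 2) => //; rewrite -derive_norm2//.
  rewrite -(near_eq_derive _ nE).
  have dn := diff_derivable dB.
  have -> : (fun y => normB y ^+ 2) = normB * normB.
    by apply/funext => y; rewrite expr2.
  by rewrite deriveM// -mulr2n -[RHS]mulr_natl.
have M0 : 0 <= nabla_sff_norm2 X e nu x.
  by do 4!(apply: sumr_ge0 => ? _); exact: sqr_ge0.
(* A zero of |B| is a global minimum, so the gradient vanishes there. *)
have [B0|Bn0] := eqVneq (normB x) 0.
  rewrite /grad_norm2 big1 ?mulr0// => k _.
  by rewrite derive_at_min ?expr0n// => y; rewrite B0.
have := @kato_traceless R n m (b x) (h x) n0 m0.
have sym12 a i j k : h x a i j k = h x a j i k.
  exact: (nabla_sff_sym openU smoothX unitG _ _ _ Ux (nu_orth _ Ux)).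
have sym23 a i j k : h x a i j k = h x a i k j.
  exact: (codazzi openU smoothX unitG _ _ _ Ux (nu_orth _ Ux)).
move=> /(_ sym12 sym23 (fun a k => nabla_sff_traceless a k Ux)).
rewrite (sum_sqr_sff Ux) -(sff_norm_sqr Ux) -/normB.
under eq_bigr => k _ do rewrite -dk exprMn.
(* Here |T|^2 = |B|^2 |grad |B||^2, and the positive factor |B|^2 cancels. *)
rewrite -mulr_sumr mulrCA ler_pM2l// exprn_gt0// lt0r Bn0 normB0 //.
Unshelve. all: by end_near. Qed.

End Frames.

Theorem lemma2p1 (R : realType) (n m : nat) (n_gt0 : (0 < n)%N)
    (m_gt0 : (0 < m)%N)
    (M : topologicalType) (A : set (chart R n M))
    (F : M -> 'rV[R]_(m + n))
    (mfdM : smooth_manifold A)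
    (immF : smooth_immersion A F)
    (minF : minimal_immersion A F)
    (c : chart R n M) (Ac : A c)
    (e : 'I_n -> 'rV[R]_n -> 'rV[R]_n)
    (nu : 'I_m -> 'rV[R]_n -> 'rV[R]_(m + n))
    (tfr : orthonormal_tangent_frame (F \o chart_param c) (chart_im c) e)
    (nfr : orthonormal_normal_frame (F \o chart_param c) (chart_im c) nu)
    (p : M) (cp : chart_dom c p) :
  let X := F \o chart_param c in
  let x := chart_coord c p in
  let normB := sff_norm X e nu in
  (normB x != 0 -> differentiable normB x) /\
  (differentiable normB x ->
     nabla_sff_norm2 X e nu x >=
       (1 + 2 / (m%:R * n%:R)) * grad_norm2 e normB x).
Proof.
have [_ _ [chartA _ _]] := mfdM.
have [_ open_im _ _ _] := chartA c Ac.
(* The assertion is local, hence reduces to the open image of one chart. *)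
apply: (kato_chart open_im (immF c Ac).1 tfr nfr (minF c Ac)) => //.
by exists p.
Qed.
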